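(* Let $e,r\in\mathbb N$ (positive integers) and let $T\colon X\to X$ be the one-dimensional Greenberg-Hastings cellular automaton with $e$ excited and $r$ refractory states. Its topological entropy satisfies $$h(X,T)=h(Z,T|_Z)=2\ln\rho_{e+r},$$ where $\rho_{e+r}$ is the positive root of $x^{e+r+1}-x^{e+r}-1$. Moreover, $h(\Omega_{\mathrm{const}},T|_{\Omega_{\mathrm{const}}})=0$, and $0<h(\Omega_{\mathrm{var}},T|_{\Omega_{\mathrm{var}}})<2\ln\rho_{e+r}$ for $r>e+1$.
   Context: Cellular automaton: $\mathfrak a=e+r+1$, $\mathcal A=\{0,1,\dots,e+r\}$, $E=\{1,\dots,e\}$ (excited states), $R=\{e+1,\dots,e+r\}$ (refractory states). $X=\mathcal A^{\mathbb Z}$ carries the product topology, induced by the metric $d(x,y)=2^{-k}$ for $x\neq y$, where $k$ is maximal with $x_{[-k,k]}=y_{[-k,k]}$ ($k=-1$ if $x_0\ne y_0$), and $d(x,x)=0$. For $x\in X$, $(Tx)_k=x_k+1$ if $1\le x_k\le e+r-1$; $(Tx)_k=0$ if $x_k=e+r$; if $x_k=0$, then $(Tx)_k=1$ when $x_{k-1}\in E$ or $x_{k+1}\in E$, and $(Tx)_k=0$ otherwise. Write $x_{[i,j]}$ for the restriction of $x$ to coordinates $i,\dots,j$ (with $i=-\infty$ or $j=\infty$ allowed). Topological entropy: for a $T$-invariant, not necessarily closed subset $M\subseteq X$, $h(M,T|_M)$ is the Bowen-Dinaburg entropy with respect to $d$: $h(M,T|_M)=\lim_{\varepsilon\to0}\limsup_{n\to\infty}\frac1n\ln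 s_M(n,\varepsilon)$, with $s_M(n,\varepsilon)$ the maximal cardinality of a subset of $M$ whose distinct points $x,y$ satisfy $\max_{0\le j<n}d(T^jx,T^jy)\geq\varepsilon$ (the usual topological entropy if $M$ is compact); the entropy on the empty set is $0$. Non-wandering set: $\Omega=\{x\in X:$ for every neighbourhood $U$ of $x$ there is $N\ge1$ with $T^N U\cap U\ne\emptyset\}$. Pulse collision subsystem $Z$: for $i,j\in\mathcal A$ put $a_{i,j}=1$ if $(i,j)=(0,0)$, or $j=i+1$ with $0\le i\le e+r-1$, or $(i,j)=(e+r,0)$; otherwise $a_{i,j}=0$. Let $S_R=\{x\in X: a_{x_i,x_{i-1}}=1\ \forall i\in\mathbb Z\}$, $S_L=\{x\in X: a_{x_i,x_{i+1}}=1\ \forall i\in\mathbb Z\}$. For $p\in\mathbb Z$ let $S_{R,p}^-$ be the set of $x\in\mathcal A^{\mathbb Z_{\le p}}$ with $a_{x_i,x_{i-1}}=1$ for all $i\le p$, and $S_{L,p}^+$ the set of $x\in\mathcal A^{\mathbb Z_{\ge p}}$ with $a_{x_i,x_{i+1}}=1$ for all $i\ge p$. Let $S_L^R$ be the set of $x\in X\setminus(S_R\cup S_L)$ for which there is $p\in\mathbb Z$ with $x_{[-\infty,p]}\in S_{R,p}^-$ and $x_{[p+1,\infty]}\in S_{L,p+1}^+$; every such $p$ is called a separating position of $x$, and the set $I_{\mathrm{sp}}(x)$ of them is finite for $x\in S_L^R$. Then $Z$ is the set of $x\in X$ such that either $x\in S_R\cup S_L$, or $x\in S_L^R$ and, with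 $p=\max I_{\mathrm{sp}}(x)$, we have $x_{p+1}=x_p$ or ($x_{[-\infty,p]}\in S_{R,p}^-$ and $x_{[p,\infty]}\in S_{L,p}^+$). Step sizes: identify $\mathcal A$ with $\mathbb Z/\mathfrak a\mathbb Z$; for $x\in X$, $p\in\mathbb Z$, $m\in\mathbb N_0$, let $s_p^m(x)=(T^m x)_{p+1}-(T^m x)_p \bmod \mathfrak a\in\mathcal A$. Let $C_\pi=\{e+1,\dots,r\}$ if $r>e$ and $C_\pi=\emptyset$ otherwise. $\Omega_{\mathrm{const}}=\{x\in\Omega\setminus Z:\ s_q^m(x)=s_q^0(x)\ \text{for all } q\in\mathbb Z,\ m\in\mathbb N\}$. For $k\in\mathbb N_0$ let $S_{R,p,-}^{k}$ (resp. $S_{L,p,+}^{k}$) be the set of elements of $S_{R,p}^-$ (resp. $S_{L,p}^+$) in which at most $k$ consecutive zeros occur. Then $$\Omega_{\mathrm{var}}=\bigcup_{p\in\mathbb Z}\{x\in\Omega\setminus\Omega_{\mathrm{const}}:\ s_p^0(x)\in C_\pi,\ x_{[-\infty,p]}\in S_{R,p,-}^{\#C_\pi},\ x_{[p+1,\infty]}\in S_{L,p+1,+}^{\#C_\pi}\}.$$ *)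

(* Defs.v *)
From HB Require Import structures.
From mathcomp Require Import all_boot all_order all_algebra.
From mathcomp Require Import all_classical all_reals all_analysis.
From mathcomp Require Import zify.

Set Implicit Arguments.
Unset Strict Implicit.
Unset Printing Implicit Defensive.

Import Order.TTheory GRing.Theory Num.Theory numFieldNormedType.Exports.

Local Open Scope classical_set_scope.
Local Open Scope ring_scope.

Section BowenDinaburg.
Context {R : realType} {X : choiceType}.
Variables (d : X -> X -> R) (T : X -> X).
Implicit Types (M A : set X) (n : nat) (eps : R).

Definition bowen_dist n (x y : X) : R :=
  \big[Num.max/0]_(j < n) d (iter j T x) (iter j T y).

Definition separated n eps A : Prop :=
  forall x y, A x -> A y -> x <> y -> eps <= bowen_dist n x y.

Definition sep_card M n eps : \bar R :=
  ereal_sup [set counting A | A in [set A | A `<=` M /\ separated n eps A]].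

Definition entropy_at M eps : \bar R :=
  limn_esup (fun n => ((n%:R^-1)%:E * lne (sep_card M n eps))%E).

(* The case distinction is needed because sep_card set0 n eps = 0, whose
   logarithm is -oo.  The limit always exists, see cvg_entropy_at. *)
Definition entropy M : \bar R :=
  if `[< M = set0 >] then 0%E else lim (entropy_at M eps @[eps --> 0^'+]).

Lemma cvg_entropy_at M : cvg (entropy_at M eps @[eps --> 0^'+]).
Proof.
apply: nonincreasing_at_right_is_cvge; apply: nearW => b eps eps' _ _ le_eps.
rewrite /entropy_at /limn_esup !limf_esupE; apply: le_ereal_inf_tmp.
move=> _ [V nV <-]; apply: ge_ereal_inf.
exists (ereal_sup [set ((n%:R^-1)%:E * lne (sep_card M n eps'))%E | n in V]).
  by exists V.
apply: ge_ereal_sup => _ [n Vn <-].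
apply: (@le_trans _ _ ((n%:R^-1)%:E * lne (sep_card M n eps))%E); last first.
  by apply: ereal_sup_ubound; exists n.
have sub : (sep_card M n eps' <= sep_card M n eps)%E.
  apply: ereal_sup_le => _ [A [sAM sepA] <-]; exists A => //; split => //.
  by move=> x y Ax Ay xy; apply: le_trans le_eps _; exact: sepA.
have ge0 d' : (0 <= sep_card M n d')%E.
  apply: ereal_sup_ubound; exists set0; first by split.
  by rewrite /counting asboolT ?fset_set0.
rewrite lee_wpmul2l ?lee_fin ?invr_ge0 ?ler0n//.
by rewrite lee_lne // in_itv/= leey ge0.
Qed.

End BowenDinaburg.

Section GreenbergHastings.
Variables e r : nat.

Definition config : Type :=
  prod_topology (fun _ : int => discrete_topology 'I_(e + r).+1).
HB.instance Definition _ := Topological.on config.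

Implicit Types (x y : config) (i j k p q : int) (m n : nat).

Definition excited (a : 'I_(e + r).+1) : bool := (0 < a <= e)%N.

Definition gh x : config := fun k =>
  if x k == 0%N :> nat then
    if excited (x (k - 1)) || excited (x (k + 1)) then inord 1 else ord0
  else if x k == (e + r)%N :> nat then ord0
  else inord (x k).+1.

(* agree x y k means that x and y coincide on [-k, k]; it holds vacuously for
   k < 0, so that agree_index x y = -1 if x 0 <> y 0. *)
Definition agree x y k : Prop := forall i, `|i| <= k -> x i = y i.

Definition agree_index x y : int :=
  xget 0 [set k | agree x y k /\ forall l, agree x y l -> l <= k].

Definition dist (R : realType) x y : R :=
  if `[< x = y >] then 0 else 2 ^ (- agree_index x y).

Lemma agree_indexP x y : x <> y ->
  agree x y (agree_index x y) /\
  forall l, agree x y l -> l <= agree_index x y.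
Proof.
move=> xy; rewrite /agree_index; case: xgetP => [_ -> //|noK].
have [i xyi] : exists i, x i <> y i.
  by apply/existsNP => xyE; apply: xy; apply/funext.
pose P n := `[< exists2 i, absz i = n & x i <> y i >].
have exP : exists n, P n by exists (absz i); apply/asboolP; exists i.
case: (ex_minnP exP) => n /asboolP[i0 i0n xyi0] minn.
case: (noK (n%:Z - 1)); split => [j jn|l agl].
  apply: contrapT => xyj; have /minn : P `|j|%N by apply/asboolP; exists j.
  by move: jn; rewrite -abszE; lia.
apply: contrapT => ln; apply: xyi0; apply: agl.
by rewrite -abszE i0n; lia.
Qed.

Lemma dist_le (R : realType) x y (k : int) :
  dist R x y <= 2 ^ (- k) <-> agree x y k.
Proof.
rewrite /dist; case: asboolP => [-> |xy].
  by split=> // _; apply/ltW/exprz_gt0.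
have [agN maxN] := agree_indexP xy.
rewrite ler_eXz2l ?ltr1n// lerN2; split => [kN i ik|/maxN//].
by apply: agN; exact: le_trans kN.
Qed.

Lemma nbhs_dist (R : realType) x (U : set config) :
  nbhs x U <-> exists2 eps : R, 0 < eps & forall y, dist R x y < eps -> U y.
Proof.
split.
  pose F : set_system config :=
    [set V | exists2 eps : R, 0 < eps & forall y, dist R x y < eps -> V y].
  have FF : Filter F.
    split; first by exists 1.
      move=> V W [a a0 aV] [b b0 bW]; exists (Num.min a b).
        by rewrite lt_min a0.
      by move=> y; rewrite lt_min => /andP[/aV ? /bW ?]; split.
    by move=> V W VW [a a0 aV]; exists a => // y /aV/VW.
  suff : F --> x by apply.
  apply/cvg_sup => i V [_ [[A oA <-] Ax] AV].
  exists (2 ^ (- `|i|)); first exact: exprz_gt0.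
  move=> y /ltW/dist_le xy; apply: AV => /=; rewrite -(xy i)//; exact: lexx.
move=> [eps eps0 epsU].
have [k keps] : exists k : nat, (2 ^ (- k%:Z) : R) < eps.
  have := @cvg_geometric R 1 2^-1; rewrite ger0_norm ?invr_ge0//.
  rewrite invf_lt1 ?ltr1n// => /(_ isT) /cvgrPdist_lt /(_ _ eps0)[k _ /(_ k)].
  rewrite /= leqnn sub0r normrN mul1r => /(_ isT) h2; exists k.
  by rewrite -exprz_inv/= -exprnP; apply: le_lt_trans h2; exact: ler_norm.
have nbhs1 i : nbhs x [set y : config | y i = x i].
  have : nbhs (x i : discrete_topology _) [set x i] by exact: discrete_set1.
  exact: (@proj_continuous _
    (fun _ : int => discrete_topology 'I_(e + r).+1) i x).
suff nbhsk : nbhs x [set y | agree x y k].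
  apply: filterS nbhsk => y /dist_le xy.
  exact/epsU/(le_lt_trans (xy R)).
elim: k {keps} => [|k IHk].
  apply: filterS (nbhs1 0) => y xy i i0.
  by rewrite (_ : i = 0)//; lia.
apply: filterS (filterI IHk (filterI (nbhs1 k.+1) (nbhs1 (- k.+1%:Z)))).
move=> y [/= xy [xyk xyNk]] i ik.
have [/xy//|ik'] := lerP `|i| k.
have [->|->] : i = k.+1 \/ i = - k.+1%:Z by lia.
  by rewrite xyk.
by rewrite xyNk.
Qed.

Definition htop (R : realType) (M : set config) : \bar R :=
  entropy (@dist R) gh M.

Definition Omega : set config :=
  [set x | forall U, nbhs x U ->
     exists2 N, (0 < N)%N & (iter N gh @` U) `&` U !=set0].

Definition adj (a b : 'I_(e + r).+1) : bool :=
  [|| (a == 0%N :> nat) && (b == 0%N :> nat),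
      b == a.+1 :> nat
    | (a == (e + r)%N :> nat) && (b == 0%N :> nat)].

Definition S_R : set config := [set x | forall i, adj (x i) (x (i - 1))].
Definition S_L : set config := [set x | forall i, adj (x i) (x (i + 1))].

(* The restriction of x to a half-line is not formed: S_Rm p, S_Lp p and their
   bounded variants below only constrain the coordinates of x in the half-line,
   so S_Rm p x says that x restricted to ]-oo, p] lies in S_{R,p}^-. *)
Definition S_Rm p : set config :=
  [set x | forall i, i <= p -> adj (x i) (x (i - 1))].
Definition S_Lp p : set config :=
  [set x | forall i, p <= i -> adj (x i) (x (i + 1))].

Definition I_sp x : set int := [set p | S_Rm p x /\ S_Lp (p + 1) x].

Definition S_LR : set config := ~` (S_R `|` S_L) `&` [set x | I_sp x !=set0].

Definition Z : set config :=
  (S_R `|` S_L) `|`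
  (S_LR `&` [set x | exists p,
     [/\ I_sp x p, forall q, I_sp x q -> q <= p
       & x (p + 1) = x p \/ (S_Rm p x /\ S_Lp p x)]]).

(* Subtraction in the group 'I_(e + r).+1 of integers modulo e + r + 1. *)
Definition step x p m : 'I_(e + r).+1 :=
  (iter m gh x (p + 1) : 'I_(e + r).+1) - (iter m gh x p : 'I_(e + r).+1).

(* Empty unless e < r. *)
Definition C_pi : {set 'I_(e + r).+1} := [set c : 'I_(e + r).+1 | (e < c <= r)%N]%SET.

Definition Omega_const : set config :=
  [set x | [/\ Omega x, ~ Z x & forall q m, step x q m = step x q 0]].

Definition zero_block x i n : Prop :=
  forall j, i <= j < i + n%:Z -> x j = ord0.

Definition S_Rm_bdd n p : set config :=
  [set x | S_Rm p x /\ forall i, i + n%:Z <= p -> ~ zero_block x i n.+1].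
Definition S_Lp_bdd n p : set config :=
  [set x | S_Lp p x /\ forall i, p <= i -> ~ zero_block x i n.+1].

Definition Omega_var : set config :=
  \bigcup_(p : int)
    [set x | [/\ Omega x, ~ Omega_const x, step x p 0 \in C_pi,
       S_Rm_bdd #|C_pi| p x & S_Lp_bdd #|C_pi| (p + 1) x]].

End GreenbergHastings.

(* Main.v *)
(* Upper bounds. The orbit of a configuration on a window [-k, k] is determined by
   its initial state there and by the columns at -k and k, so the entropy is at most
   twice the growth rate of the words that can occur in a column. In general this
   growth rate is rho. On Omega_const all sites advance simultaneously until the
   configuration dies out, so columns grow linearly in number. On Omega_var a step
   that leaves C_pi can never return to it, so by non-wandering the step at p stays
   in C_pi forever; then the two half-lines do not interact and are merely shifted,
   so columns have bounded runs of zeros, whose growth rate is smaller than rho.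

   Lower bounds. Lift the states to integer heights. If F and G are the heights of
   a right-moving and a left-moving wave, then max(F(t - q), G(t + q)) is a lift of
   an orbit. When F and G are concatenations of blocks of fixed length and fixed
   height, all the collisions happen in a bounded window and both waves can be read
   off there; by the pigeonhole principle some height gives the growth rate rho for
   each wave. For Omega_var one glues two copies of a wave with a phase difference
   that stays in C_pi; periodic waves give periodic, hence non-wandering, points. *)

Require Import Defs.
From mathcomp Require Import all_boot all_order all_algebra.
From mathcomp Require Import all_classical all_reals all_analysis.
From mathcomp Require Import finmap zify ring lra.
Import Order.TTheory GRing.Theory Num.Theory numFieldNormedType.Exports.

Set Implicit Arguments.
Unset Strict Implicit.
Unset Printing Implicit Defensive.

Local Open Scope classical_set_scope.
Local Open Scope ring_scope.

(** * Bounds on the entropy from separated sets *)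

Section SeparatedSets.
Context {R : realType} {X : choiceType}.
Variables (d : X -> X -> R) (T : X -> X).
Implicit Types (M : set X) (n : nat) (eps : R).

(** Distinct points of a separated set cannot share a code, so every finite subset, and with it the
    whole set, has at most [size s] elements. *)
Lemma sep_card_le_code (D : eqType) (code : X -> D) (s : seq D) M n eps :
    (forall x, M x -> code x \in s) ->
    (forall x y, M x -> M y -> code x = code y -> bowen_dist d T n x y < eps) ->
  (sep_card d T M n eps <= (size s)%:R%:E)%E.
Proof.
move=> codeM codeI; apply: ge_ereal_sup => _ [A [AM sepA] <-].
have codeA x y : A x -> A y -> code x = code y -> x = y.
  move=> Ax Ay xy; apply: contrapT => /(sepA _ _ Ax Ay).
  by rewrite leNgt codeI//; exact: AM.
have small (B : {fset X}) : [set` B] `<=` A -> (#|` B| <= size s)%N.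
  move=> BA; rewrite -(size_map code); apply: uniq_leq_size.
    rewrite map_inj_in_uniq ?fset_uniq// => x y Bx By.
    by apply: codeA; exact: BA.
  by move=> _ /mapP[x Bx ->]; apply/codeM/AM/BA.
rewrite /counting; case: asboolP => [finA|infA].
  rewrite lee_fin ler_nat; apply: small => x /=.
  by rewrite in_fset_set// => /set_mem.
have [B /small] := infinite_set_fset (size s).+1 infA.
by move=> h1 h2; have := leq_trans h2 h1; rewrite ltnn.
Qed.

Lemma sep_card_ge_family (I : finType) (psi : I -> X) M n eps :
    (forall i, M (psi i)) -> 0 < eps ->
    (forall i j, i != j -> exists2 t, (t < n)%N &
        eps <= d (iter t T (psi i)) (iter t T (psi j))) ->
    (forall x, d x x < eps) ->
  (#|I|%:R%:E <= sep_card d T M n eps)%E.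
Proof.
move=> psiM eps0 sep dxx.
have psiI : injective psi.
  move=> i j ij; apply/eqP; apply: contrapT => /negP /sep[t _].
  by rewrite ij leNgt dxx.
apply: ereal_sup_ubound; exists (range psi).
  split; first by move=> _ [i _ <-].
  move=> _ _ [i _ <-] [j _ <-] ij.
  have [|t tn epst] := sep i j; first by apply/eqP => ij'; apply: ij; rewrite ij'.
  by apply: le_trans epst _; exact: (le_bigmax _ _ (Ordinal tn)).
have fin : finite_set (range psi) by exact: finite_image.
rewrite /counting asboolT//; congr (_%:R%:E).
rewrite cardE -(size_map psi); apply/esym/perm_size/uniq_perm.
- by rewrite map_inj_uniq ?enum_uniq.
- exact: fset_uniq.
move=> x; rewrite in_fset_set//; apply/mapP/idP => [[i _ ->]|/set_mem[i _ <-]].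
  by apply: mem_set; exists i.
by exists i; rewrite // mem_enum.
Qed.

Lemma sep_card_ge0 M n eps : (0 <= sep_card d T M n eps)%E.
Proof.
apply: ereal_sup_ubound; exists set0; first by split.
by rewrite /counting asboolT ?fset_set0.
Qed.

Lemma entropy_le M th : 1 <= th ->
    (forall eps, 0 < eps ->
       exists C, forall n, (sep_card d T M n eps <= (C * th ^+ n)%:E)%E) ->
  (entropy d T M <= (ln th)%:E)%E.
Proof.
move=> th1 bound; rewrite /entropy; case: asboolP => _.
  by rewrite lee_fin ln_ge0.
apply: lime_le; first exact: cvg_entropy_at.
near=> eps; have /bound[C0 C0P] : 0 < eps by near: eps; exact: nbhs_right_gt.
pose C := Num.max 1 C0.
have C1 : 1 <= C by rewrite le_max lexx.
have CP n : (sep_card d T M n eps <= (C * th ^+ n)%:E)%E.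
  apply: le_trans (C0P n) _; rewrite lee_fin ler_wpM2r ?exprn_ge0//.
    by rewrite (le_trans ler01).
  by rewrite le_max lexx orbT.
apply/lee_addgt0Pr => eta eta0; apply: ge_ereal_inf.
pose n0 := (Num.truncn (ln C / eta)).+1.
exists (ereal_sup [set ((n%:R^-1)%:E * lne (sep_card d T M n eps))%E
                  | n in [set n | (n0 <= n)%N]]).
  by exists [set n | (n0 <= n)%N] => //; exact: nbhs_infty_ge.
apply: ge_ereal_sup => _ [n /= n0n <-].
have th0 : 0 < th by rewrite (lt_le_trans ltr01).
have C00 : 0 < C by rewrite (lt_le_trans ltr01).
have n_gt0 : (0 : R) < n%:R by rewrite ltr0n; apply: leq_trans n0n.
apply: (@le_trans _ _ ((n%:R^-1)%:E * lne ((C * th ^+ n)%:E))%E).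
  rewrite lee_wpmul2l ?lee_fin ?invr_ge0 ?ler0n// lee_lne//.
    by rewrite in_itv/= leey sep_card_ge0.
  by rewrite in_itv/= leey lee_fin mulr_ge0 ?exprn_ge0// ltW.
rewrite lne_EFin ?mulr_gt0 ?exprn_gt0// lnM ?posrE ?exprn_gt0// lnXn//.
rewrite -EFinM -EFinD lee_fin ler_pdivrMl// mulrDr -(mulr_natl (ln th)).
rewrite addrC lerD2l -ler_pdivrMr//.
apply/ltW/(lt_le_trans (truncnS_gt _)).
by rewrite ler_nat.
Unshelve. all: by end_near. Qed.

(** A limsup is bounded below along a subsequence, so counting at the multiples of [L] suffices. *)
Lemma entropy_ge M eps N L : (0 < N)%N -> (0 < L)%N -> 0 < eps ->
    (forall q, (0 < q)%N -> ((N ^ q)%:R%:E <= sep_card d T M (q * L) eps)%E) ->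
  ((ln N%:R / L%:R)%:E <= entropy d T M)%E.
Proof.
move=> N0 L0 eps0 bound; rewrite /entropy; case: asboolP => [M0|_].
  have := bound 1%N isT; rewrite M0 leNgt => /negP[].
  apply: (@le_lt_trans _ _ 0%E); last by rewrite lte_fin ltr0n expn_gt0 N0.
  apply: ge_ereal_sup => _ [A [+ _] <-]; rewrite subset0 => ->.
  by rewrite /counting asboolT ?fset_set0.
apply: lime_ge; first exact: cvg_entropy_at.
near=> eps'.
have eps'0 : 0 < eps' by near: eps'; exact: nbhs_right_gt.
have eps'eps : eps' <= eps by near: eps'; exact: nbhs_right_ltW.
have {}bound q : (0 < q)%N -> ((N ^ q)%:R%:E <= sep_card d T M (q * L) eps')%E.
  move=> /bound /le_trans; apply; apply: ereal_sup_le => _ [A [AM sepA] <-].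
  exists A => //; split=> // x y Ax Ay xy.
  by apply: le_trans eps'eps _; exact: sepA.
apply: le_ereal_inf_tmp => _ [V [n _ nV] <-].
apply: le_trans (ereal_sup_ubound _); last first.
  by exists (n.+1 * L)%N => //; apply: nV => /=; nia.
have Nn0 : (0 : R) < (N ^ n.+1)%:R by rewrite ltr0n expn_gt0 N0.
apply: (@le_trans _ _ (((n.+1 * L)%:R^-1)%:E * lne ((N ^ n.+1)%:R%:E))%E).
  rewrite lne_EFin// natrX lnXn ?ltr0n// -EFinM lee_fin natrM.
  by rewrite -(mulr_natl (ln _)) invfM -mulrA mulrCA mulKf ?pnatr_eq0// mulrC.
rewrite lee_wpmul2l ?lee_fin ?invr_ge0 ?ler0n// lee_lne ?bound//.
  by rewrite in_itv/= leey lee_fin ltW.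
by rewrite in_itv/= leey sep_card_ge0.
Unshelve. all: by end_near. Qed.

Lemma entropy_ge0 M : (0 <= entropy d T M)%E.
Proof.
rewrite /entropy; case: asboolP => // M0.
apply: lime_ge; first exact: cvg_entropy_at.
near=> eps.
apply: le_ereal_inf_tmp => _ [V [n _ nV] <-].
apply: le_trans (ereal_sup_ubound _); last first.
  by exists n => //; apply: nV => /=.
rewrite mule_ge0 ?lee_fin ?invr_ge0// lne_ge0.
have [x Mx] : M !=set0 by apply/set0P/eqP.
apply: ereal_sup_ubound; exists [set x]; first by split => [_ ->//|_ _ -> ->].
by rewrite /counting asboolT ?fset_set1 ?cardfs1.
Unshelve. all: by end_near. Qed.

End SeparatedSets.

(** * Counting columns *)

Section Paths.
Variables (S : finType) (E : rel S).

Fixpoint paths n (v : S) : seq (seq S) :=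
  if n is m.+1 then [seq v :: w | v' <- enum (E v), w <- paths m v']
  else [:: [:: v]].

Lemma mem_paths n (f : nat -> S) :
  (forall t, E (f t) (f t.+1)) -> mkseq f n.+1 \in paths n (f 0%N).
Proof.
elim: n f => [|n IHn] f Ef; first by rewrite inE.
rewrite (_ : mkseq f n.+2 = f 0%N :: mkseq (f \o succn) n.+1); last first.
  by rewrite /mkseq /= -[2%N]addn1 iotaDl -map_comp.
apply/allpairsPdep; exists (f 1%N), (mkseq (f \o succn) n.+1); split=> //.
  by rewrite mem_enum; exact: Ef.
by apply: IHn => t; exact: Ef.
Qed.

(** Perron-Frobenius estimate: each step multiplies the total weight of the endpoints of the walks
    by at most [mu], and [c] converts weight into a count. *)
Lemma size_paths_le (R : realType) (wt : S -> R) c mu n v : 0 <= mu ->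
    (forall u, c <= wt u) ->
    (forall u, \sum_(u' | E u u') wt u' <= mu * wt u) ->
  c * (size (paths n v))%:R <= mu ^+ n * wt v.
Proof.
move=> mu0 cwt sup; elim: n v => [|n IHn] v; first by rewrite mulr1 mul1r.
rewrite /= size_allpairs_dep sumnE big_map natr_sum mulr_sumr exprSr -mulrA.
apply: (@le_trans _ _ (mu ^+ n * \sum_(u | E v u) wt u)); last first.
  by rewrite ler_wpM2l ?exprn_ge0.
by rewrite big_enum/= mulr_sumr; apply: ler_sum => u _; exact: IHn.
Qed.

End Paths.

#[local] Arguments gh {e r}.

Section ColumnCoding.
Context {e r : nat}.
Implicit Types (x y : config e r) (q : int) (n k t : nat).

Lemma gh_local x y q : x (q - 1) = y (q - 1) -> x q = y q ->
  x (q + 1) = y (q + 1) -> gh x q = gh y q.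
Proof. by rewrite /gh => -> -> ->. Qed.

Lemma agree_columns k n x y : agree x y k%:Z ->
    (forall t, (t < n)%N -> iter t gh x (- k%:Z) = iter t gh y (- k%:Z)) ->
    (forall t, (t < n)%N -> iter t gh x k%:Z = iter t gh y k%:Z) ->
  forall t, (t < n)%N -> agree (iter t gh x) (iter t gh y) k%:Z.
Proof.
move=> xy colL colR; elim=> [_ //|t IHt tn] q qk.
have {}IHt := IHt (ltnW tn).
have [->|qL] := eqVneq q (- k%:Z); first exact: colL.
have [->|qR] := eqVneq q k%:Z; first exact: colR.
by apply: gh_local; apply: IHt; lia.
Qed.

(* An orbit restricted to [-k, k] x [0, n[ is determined by its initial state
   and by the two columns at -k and k, so that columns of growth rate mu
   contribute mu ^ 2. *)
Lemma htop_le_columns (R : realType) (S : finType) (E : rel S)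
    (pr : S -> 'I_(e + r).+1) (f : config e r -> int -> nat -> S)
    (M : set (config e r)) (wt : S -> R) c mu : 1 <= mu -> 0 < c ->
    (forall u, c <= wt u) ->
    (forall u, \sum_(u' | E u u') wt u' <= mu * wt u) ->
    (forall x q t, M x -> E (f x q t) (f x q t.+1)) ->
    (forall x q t, M x -> pr (f x q t) = iter t gh x q) ->
  (htop R M <= (2 * ln mu)%:E)%E.
Proof.
move=> mu1 c0 cwt sup fE fpr.
have mu_gt0 : 0 < mu by rewrite (lt_le_trans ltr01).
rewrite mulr_natl -lnXn//; apply: entropy_le; first by rewrite exprn_ege1.
move=> eps eps0.
have [k keps] : exists k : nat, 2 ^ (- k%:Z) < eps.
  exists (Num.truncn eps^-1).+1; rewrite -exprz_inv -exprnP exprVn.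
  rewrite invf_plt ?posrE ?exprn_gt0//; apply: lt_trans (truncnS_gt _) _.
  by rewrite -natrX ltr_nat ltn_expl.
pose win x : {ffun 'I_(k + k).+1 -> 'I_(e + r).+1} :=
  [ffun i : 'I__ => x (i%:Z - k%:Z)].
pose P n := flatten [seq paths E n v | v <- enum S].
pose W := \sum_v wt v / c.
have W0 : 0 <= W.
  by apply: sumr_ge0 => v _; rewrite divr_ge0 ?(le_trans _ (cwt v)) ?ltW.
have sizeP n : (size (P n))%:R <= W * mu ^+ n.
  rewrite /P size_flatten /shape -map_comp sumnE big_map big_enum/= natr_sum.
  rewrite mulr_suml; apply: ler_sum => v _.
  rewrite mulrAC ler_pdivlMr// mulrC [leRHS]mulrC.
  by apply: size_paths_le => //; exact: ltW.
exists (#|{ffun 'I_(k + k).+1 -> 'I_(e + r).+1}|%:R * (W * W)) => n.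
pose code x := (win x, (mkseq (f x (- k%:Z)) n.+1, mkseq (f x k%:Z) n.+1)).
pose s := [seq (w, p) | w <- enum {ffun 'I_(k + k).+1 -> 'I_(e + r).+1},
                        p <- [seq (p1, p2) | p1 <- P n, p2 <- P n]].
apply: (@le_trans _ _ (size s)%:R%:E).
  apply: (@sep_card_le_code _ _ _ _ _ code) => [x Mx|x y Mx My xyE].
    have memP q : mkseq (f x q) n.+1 \in P n.
      apply/flattenP; exists (paths E n (f x q 0%N)).
        by apply: map_f; rewrite mem_enum.
      by apply: mem_paths => t; exact: fE.
    by rewrite /s !allpairs_f ?mem_enum ?memP.
  have winE : win x = win y := congr1 fst xyE.
  have LE : mkseq (f x (- k%:Z)) n.+1 = mkseq (f y (- k%:Z)) n.+1 :=
    congr1 (fst \o snd) xyE.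
  have RE : mkseq (f x k%:Z) n.+1 = mkseq (f y k%:Z) n.+1 :=
    congr1 (snd \o snd) xyE.
  apply: bigmax_lt => // t _; apply: le_lt_trans keps; apply/dist_le.
  apply: agree_columns (ltn_ord t) => [q qk|{}t tn|{}t tn].
  - have qk' : (absz (q + k%:Z)%R < (k + k).+1)%N by lia.
    have := congr1 (fun g : {ffun _ -> _} => g (Ordinal qk')) winE.
    by rewrite !ffunE /= (_ : (absz (q + k%:Z))%:Z - k%:Z = q)//; lia.
  - have := congr1 (fun w => nth (f x (- k%:Z) 0%N) w t) LE.
    by rewrite !nth_mkseq ?ltnS ?(ltnW tn)// => /(congr1 pr); rewrite !fpr//.
  - have := congr1 (fun w => nth (f x k%:Z 0%N) w t) RE.
    by rewrite !nth_mkseq ?ltnS ?(ltnW tn)// => /(congr1 pr); rewrite !fpr//.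
rewrite lee_fin /s !size_allpairs -cardE !natrM -mulrA ler_wpM2l ?ler0n//.
have -> : W * W * (mu ^+ 2) ^+ n = (W * mu ^+ n) * (W * mu ^+ n).
  by rewrite -exprM mulnC exprM; ring.
by apply: ler_pM.
Qed.

End ColumnCoding.

(** A positive root exceeds 1, and beyond 1 the function [x ^+ m * (x - 1)] is a product of
    increasing factors, so it takes the value 1 at most once. Existence is the intermediate value
    theorem on [1, 2]. *)
Lemma characteristic_root (R : realType) m : (0 < m)%N ->
  exists rho : R, [/\ 1 < rho, rho ^+ m.+1 = rho ^+ m + 1 &
    forall x, 0 < x -> x ^+ m.+1 = x ^+ m + 1 -> x = rho].
Proof.
move=> m0; pose p : {poly R} := 'X^(m.+1) - 'X^m - 1.
have pE x : p.[x] = x ^+ m.+1 - x ^+ m - 1 by rewrite !hornerE.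
have gt1 (x : R) : 0 < x -> x ^+ m.+1 = x ^+ m + 1 -> 1 < x.
  move=> x0 xE; rewrite ltNge; apply/negP => x1.
  have : x ^+ m.+1 <= x ^+ m by rewrite exprS ler_piMl// exprn_ge0 ?ltW.
  by rewrite xE; lra.
have mono (x y : R) : 1 < x -> x < y ->
    x ^+ m.+1 - x ^+ m < y ^+ m.+1 - y ^+ m.
  move=> x1 xy; have x0 : 0 < x by lra.
  have powE (z : R) : z ^+ m.+1 - z ^+ m = z ^+ m * (z - 1).
    by rewrite exprSr; ring.
  rewrite !powE; apply: ltr_pM.
  - by rewrite exprn_ge0 ?ltW.
  - by lra.
  - by rewrite ltrXn2r -?lt0n//; lra.
  - by rewrite ltrD2r.
have [rho /andP[rho1 _] rhoP] : exists2 x, 1 <= x <= 2 & root p x.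
  apply: poly_ivt; first by rewrite ler1n.
  rewrite !pE !expr1n subrr sub0r oppr_le0 ler01 /= exprS -natrX.
  have : 1 <= (2 ^ m)%:R :> R by rewrite ler1n expn_gt0.
  lra.
have rhoE : rho ^+ m.+1 = rho ^+ m + 1.
  by move: rhoP; rewrite rootE pE => /eqP; lra.
have rho0 : 0 < rho by lra.
exists rho; split=> [||x x0 xE]; [exact: gt1|exact: rhoE|].
have := mono x rho (gt1 _ x0 xE); have := mono rho x (gt1 _ rho0 rhoE).
rewrite xE rhoE; case: ltgtP => // _.
- by move=> /(_ isT); lra.
- by move=> _ /(_ isT); lra.
Qed.

Lemma sum_le_seq (R : realType) (S : finType) (P : pred S) (wt : S -> R) s :
    (forall u, 0 <= wt u) -> (forall u, P u -> u \in s) ->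
  \sum_(u | P u) wt u <= \sum_(u <- s) wt u.
Proof.
move=> wt0; elim: s P => [|v s IHs] P Ps.
  by rewrite big_nil big_pred0// => u; apply/negP => /Ps.
rewrite big_cons; have [Pv|nPv] := boolP (P v).
  rewrite (bigD1 v)//= lerD2l; apply: IHs => u /andP[/Ps].
  by rewrite inE => /predU1P[->|//]; rewrite eqxx.
apply: ler_wpDl => //; apply: IHs => u Pu; have := Ps _ Pu.
by rewrite inE => /predU1P[uv|//]; rewrite -uv Pu in nPv.
Qed.

Section Columns.
Context {e r : nat}.
Hypothesis (e0 : (0 < e)%N) (r0 : (0 < r)%N).
Implicit Types (x y : config e r) (q : int) (n k t : nat).
Local Notation A := 'I_(e + r).+1.

Lemma gh_val x q : gh x q =
  (if x q == 0%N :> nat then excited (x (q - 1)) || excited (x (q + 1)) : nat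
   else if x q == (e + r)%N :> nat then 0%N else (x q).+1) :> nat.
Proof.
rewrite /gh; case: ifP => xq0.
  by case: ifP => _ //=; rewrite inordK// ltnS; lia.
case: ifP => // xqer; rewrite inordK//; have := ltn_ord (x q); lia.
Qed.

Lemma adjE (a b : A) : adj a b =
  (if a == 0%N :> nat then b <= 1 else if a == (e + r)%N :> nat then b == 0 :> nat
   else b == a.+1 :> nat)%N.
Proof.
rewrite /adj; have := ltn_ord a; have := ltn_ord b.
by case: ifP => a0; [|case: ifP => aer]; lia.
Qed.

Lemma gh_adj x q : adj (x q) (gh x q).
Proof.
rewrite adjE gh_val; case: (nat_of_ord (x q) == 0%N).
  by case: (_ || _).
by case: (nat_of_ord (x q) == _).
Qed.

Lemma htop_le (R : realType) (rho : R) (M : set (config e r)) :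
  1 < rho -> rho ^+ (e + r).+1 = rho ^+ (e + r) + 1 ->
  (htop R M <= (2 * ln rho)%:E)%E.
Proof.
move=> rho1 rhoE; have rho0 : 0 < rho by lra.
(* Perron eigenvector of the transition graph of a single site *)
pose wt (i : A) := if i == 0%N :> nat then rho ^+ (e + r).+1 else rho ^+ i.
have wt1 i : 1 <= wt i by rewrite /wt; case: ifP => _; rewrite exprn_ege1// ltW.
apply: (@htop_le_columns _ _ _ _ (fun i j => adj i j) id
  (fun x q t => iter t gh x q) M wt 1 rho) => //; first exact: ltW.
- move=> u; pose s : seq A := if u == 0%N :> nat then [:: ord0; inord 1]
    else if u == (e + r)%N :> nat then [:: ord0] else [:: inord u.+1].
  apply: (@le_trans _ _ (\sum_(v <- s) wt v)).
    apply: sum_le_seq => [v|v]; first exact: le_trans (wt1 v).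
    rewrite adjE /s; case: ifP => u0.
      rewrite !inE -!val_eqE /= inordK; lia.
    case: ifP => uer; rewrite !inE -!val_eqE //=.
    by rewrite inordK//; have := ltn_ord u; lia.
  rewrite /s /wt; case: ifP => u0.
    rewrite !big_cons big_nil /= inordK /=; last by lia.
    by rewrite [rho ^+ (e + r).+1 in leRHS]rhoE exprS expr1 mulrDr mulr1 addr0.
  case: ifP => uer; rewrite big_cons big_nil addr0 /=.
    by rewrite (eqP uer) -exprS.
  by rewrite inordK/= -?exprS//; have := ltn_ord u; lia.
- by move=> x q t _; exact: gh_adj.
Qed.

End Columns.

(** * Constant steps *)

Section Subtraction.
Variable n : nat.
Implicit Types a b : 'I_n.+1.

Lemma ord_sub_val a b :
  (a - b = (if b <= a then a - b else a + n.+1 - b)%N :> nat).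
Proof.
have := ltn_ord a; have := ltn_ord b => bn an.
rewrite /=; have [->|b0] := eqVneq (b : nat) 0%N.
  by rewrite subn0 modnn addn0 modn_small// leq0n subn0.
rewrite (@modn_small (n.+1 - b)); last by lia.
case: leqP => ab.
  by rewrite (_ : a + (n.+1 - b) = (a - b) + n.+1)%N ?modnDr ?modn_small//; lia.
by rewrite modn_small; lia.
Qed.

End Subtraction.

Section Const.
Context {e r : nat}.
Hypothesis (e0 : (0 < e)%N) (r0 : (0 < r)%N).
Implicit Types (x y : config e r) (q : int) (n k t : nat).
Local Notation A := 'I_(e + r).+1.

Lemma gh_zero x : (forall q, x q = ord0) -> forall q, gh x q = ord0.
Proof.
by move=> x0 q; apply/val_inj; rewrite /= gh_val// /excited !x0.
Qed.

Lemma gh_nonzero x q : x q <> ord0 -> gh x q = (x q : A) + inord 1.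
Proof.
move=> xq0; have xq0' : (x q == 0%N :> nat) = false.
  by apply/eqP => xq; apply: xq0; apply/val_inj.
apply/val_inj; rewrite /= gh_val// xq0' inordK; last by lia.
case: eqP => [->|xqer]; first by rewrite addn1 modnn.
by rewrite modn_small addn1//; have := ltn_ord (x q); lia.
Qed.

(* As soon as one site is non-zero it advances, and constancy of the steps
   forces all sites to advance with it. *)
Lemma step_const_gh x :
    (forall q, (gh x (q + 1) : A) - gh x q = (x (q + 1) : A) - x q) ->
    (exists q, x q <> ord0) ->
  forall q, gh x q = (x q : A) + inord 1.
Proof.
move=> stepx [q0 xq0]; pose D q : A := (gh x q : A) - x q.
have DS q : D (q + 1) = D q.
  have swap (V : zmodType) (a b c d : V) : a - b = c - d -> a - c = b - d.
    move=> abcd; rewrite -[a](subrK b) abcd.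
    by rewrite addrAC (addrC c) addrK addrC.
  exact: swap.
have D0 q : D q = D 0.
  elim: q => [//|n IHn|n IHn].
    by rewrite -IHn -(DS n%:Z); congr D; lia.
  by rewrite -IHn -(DS (- n.+1%:Z)); congr D; lia.
move=> q; apply/eqP; rewrite -subr_eq0 opprD addrA subr_eq0 -/(D q).
by rewrite D0 -(D0 q0) /D gh_nonzero// addrC addKr.
Qed.

(** Until the configuration dies every next state is forced, and afterwards all states are 0, so the
    only freedom in a column is the time of death. The flag [alive] records it, and any growth rate
    [th] above 1 is admissible. *)
Lemma htop_Omega_const_le (R : realType) (th : R) : 1 < th ->
  (htop R (@Omega_const e r) <= (2 * ln th)%:E)%E.
Proof.
move=> th1; have th10 : 0 < (th - 1)^-1 by rewrite invr_gt0 subr_gt0.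
pose E (u v : A * bool) :=
  if u.2 then v.1 == (u.1 : A) + inord 1 else (v.1 == ord0) && ~~ v.2.
pose alive x := `[< exists q, x q <> ord0 >].
(* With w = 1 / (th - 1) on living states, the two successors of such a state weigh w + 1 = th *
   w. *)
pose wt (u : A * bool) := if u.2 then (th - 1)^-1 else 1.
have wt_ge u : Num.min 1 (th - 1)^-1 <= wt u.
  by rewrite /wt ge_min; case: ifP; rewrite lexx ?orbT.
apply: (@htop_le_columns _ _ _ _ E fst
  (fun x q t => (iter t gh x q : A, alive (iter t gh x))) _ wt _ th _ _ wt_ge).
- exact: ltW.
- by rewrite lt_min ltr01.
- move=> [a []]; rewrite /E /=.
    apply: (@le_trans _ _
      (\sum_(u <- [:: ((a : A) + inord 1, true); ((a : A) + inord 1, false)]) wt u)).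
      apply: sum_le_seq => [u|[b c] /= /eqP ->].
        by apply: le_trans (wt_ge u); rewrite le_min ler01 ltW.
      by case: c; rewrite !inE eqxx ?orbT.
    rewrite !big_cons big_nil /wt /= addr0.
    have : (th - 1) * (th - 1)^-1 = 1 by rewrite mulfV// gt_eqF// subr_gt0.
    lra.
  apply: (@le_trans _ _ (\sum_(u <- [:: (ord0 : A, false)]) wt u)).
    apply: sum_le_seq => [u|[b c] /= /andP[/eqP -> /negPf ->]].
      by apply: le_trans (wt_ge u); rewrite le_min ler01 ltW.
    by rewrite inE.
  by rewrite big_seq1 /wt /= mulr1 ltW.
- move=> x q t [_ _ stepx]; rewrite /E /alive /=; case: asboolP => ex.
    apply/eqP; apply: step_const_gh => // q'.
    by have := stepx q' t.+1; rewrite -(stepx q' t).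
  have zero q' : iter t gh x q' = ord0 by apply: contrapT => ?; apply: ex; exists q'.
  rewrite gh_zero// eqxx /=; apply/asboolPn => -[q' []]; exact: gh_zero.
- by [].
Qed.

End Const.

(** * Steps in C_pi *)

Section CPi.
Context {e r : nat}.
Hypothesis (e0 : (0 < e)%N) (r0 : (0 < r)%N).
Implicit Types (x y : config e r) (p q : int) (n k t : nat).
Local Notation A := 'I_(e + r).+1.

(** The step changes only when one site stays at 0 while the other advances. For r > e, the
    complement of [C_pi] consists of the residues at distance at most e from 0. There a site that is
    ahead by 1 to e is excited when the other one is at 0 and wakes it. Hence only the site ahead
    can rest, which brings the two closer; from step 0 the distance becomes at most 1 <= e. *)
Lemma step_notin_C_pi x p m n : (m <= n)%N ->
  step x p m \notin C_pi e r -> step x p n \notin C_pi e r.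
Proof.
move=> /subnKC <-; elim: (n - m)%N => [|k IHk]; first by rewrite addn0.
move=> /IHk; rewrite addnS /step /=; set y := iter _ _ x.
rewrite !inE !ord_sub_val; have := gh_val e0 r0 y p; have := gh_val e0 r0 y (p + 1).
rewrite (_ : p + 1 - 1 = p); last by lia.
move: (ltn_ord (y p)) (ltn_ord (y (p + 1))).
move: (excited (y (p - 1))) (excited (y (p + 1 + 1))) => a b.
rewrite /excited; move: (nat_of_ord (gh y p)) (nat_of_ord (gh y (p + 1))).
move: (nat_of_ord (y p)) (nat_of_ord (y (p + 1))) => u v u' v'.
case: (leqP u v) => uv; case: (leqP u' v') => uv'.
all: case: (u =P 0%N) => u0; case: (v =P 0%N) => v0; rewrite ?u0 ?v0 /=.
all: try (case: eqP => ?); try (case: eqP => ?).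
all: by case: a; case: b; lia.
Qed.

Lemma agree_iter x y (k : int) n :
  agree x y k -> agree (iter n gh x) (iter n gh y) (k - n%:Z).
Proof.
move=> xy; elim: n => [|n IHn] q qk /=; first by apply: xy; lia.
by apply: gh_local; apply: IHn; lia.
Qed.

Lemma nbhs_agree (R : realType) x (k : int) : nbhs x [set y | agree x y k].
Proof.
apply/(nbhs_dist R); exists (2 ^ (- k)); first exact: exprz_gt0.
by move=> y /ltW/dist_le.
Qed.

(* Steps outside C_pi stay outside, hence a step that leaves C_pi cannot recur. *)
Lemma Omega_step_C_pi (R : realType) x p : Omega x -> step x p 0 \in C_pi e r ->
  forall m, step x p m \in C_pi e r.
Proof.
move=> Ox step0 m; apply: contrapT => /negP stepm.
have stepE y y' n n' : (forall q, `|q| <= `|p| + 1 ->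
    iter n gh y q = iter n' gh y' q) -> step y p n = step y' p n'.
  by move=> yy'; rewrite /step !yy'//; lia.
(* The radius leaves room for transporting the agreement over m steps, or over m returns of length
   [N <= m]. *)
pose k : int := `|p| + 1 + (m + m * m)%:Z.
have [N N0 [_ [[y xy <-] xNy]]] := Ox _ (nbhs_agree R x k).
have [mN|Nm] := ltnP m N.
  have ystepm : step y p m \notin C_pi e r.
    rewrite (stepE y x m m) // => q qk.
    by apply/esym/(agree_iter xy); rewrite /k; lia.
  have /negP := step_notin_C_pi (ltnW mN) ystepm; apply.
  rewrite (stepE y x N 0%N)// => q qk.
  by apply/esym/xNy; rewrite /k; lia.
(* After an early return, N is almost a period of x; m of these periods reach a time [m * N >= m],
   where the step must be outside [C_pi] and yet equal the initial one. *)
have xN : agree (iter N gh x) x (k - N%:Z).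
  by move=> q qk; rewrite (agree_iter xy)//; apply/esym/xNy; lia.
have xjN j : agree (iter (j * N) gh x) x (k - (j * N)%:Z).
  elim: j => [|j IHj] q qk //.
  rewrite mulSn iterD -(xN q); last by lia.
  by apply: (agree_iter IHj); lia.
have /negP := step_notin_C_pi (leq_pmulr m N0) stepm; apply.
rewrite (stepE x x _ 0%N)// => q qk.
by apply: xjN; rewrite /k; nia.
Qed.

(** The first hypothesis makes copying the left neighbour a legal move of q; only a site at 0, woken
    from the right, could do otherwise. *)
Lemma gh_shift_left x q : adj (x q) (x (q - 1)) ->
  (x q = 0%N :> nat -> ~~ excited (x (q + 1))) -> gh x q = x (q - 1).
Proof.
rewrite adjE//; case: eqP => [x0 le1 /(_ x0)/negPf exq|x0 adjq _];
  apply/val_inj; rewrite /= gh_val//.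
  by rewrite x0 /= exq orbF /excited; move: le1 e0; lia.
by move/eqP/negPf: x0 adjq => ->; case: ifP => _ /eqP.
Qed.

Lemma gh_shift_right x q : adj (x q) (x (q + 1)) ->
  (x q = 0%N :> nat -> ~~ excited (x (q - 1))) -> gh x q = x (q + 1).
Proof.
rewrite adjE//; case: eqP => [x0 le1 /(_ x0)/negPf exq|x0 adjq _];
  apply/val_inj; rewrite /= gh_val//.
  by rewrite x0 /= exq /excited; move: le1 e0; lia.
by move/eqP/negPf: x0 adjq => ->; case: ifP => _ /eqP.
Qed.

Lemma adj_zero_not_excited (a b : A) : adj a b -> b = 0%N :> nat -> ~~ excited a.
Proof.
rewrite adjE// => + b0; rewrite b0 /excited.
case: eqP => [->//|_]; case: eqP => [->|_]; [by move: e0 r0; lia|by []].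
Qed.

(* A step in C_pi decouples the two half-lines: neither of the sites p and p + 1
   can excite the other one. *)
Lemma iter_gh_C_pi x p : S_Rm p x -> S_Lp (p + 1) x ->
    (forall m, (forall q, iter m gh x q = x (if q <= p then q - m%:Z else q + m%:Z)) ->
       step x p m \in C_pi e r) ->
  forall t q, iter t gh x q = x (if q <= p then q - t%:Z else q + t%:Z).
Proof.
move=> xR xL stepC; elim=> [|t IHt] q.
  by case: ifP; rewrite ?subr0 ?addr0.
have := stepC t IHt; rewrite /step inE ord_sub_val; set y := iter t gh x => yC.
have yE q' : y q' = x (if q' <= p then q' - t%:Z else q' + t%:Z) := IHt q'.
rewrite [LHS]/= -/y; case: ifP => qp.
  rewrite gh_shift_left.
  - by rewrite yE (_ : q - 1 <= p); [congr x|]; lia.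
  - rewrite !yE (_ : q - 1 <= p) ?qp; last by lia.
    by rewrite addrAC; apply: xR; lia.
  (* If p is at 0, the state of p + 1 is the step itself, which exceeds e. *)
  have [->|qp'] := eqVneq q p.
    move=> y0; move: yC; rewrite y0 leq0n subn0 /excited; lia.
  apply: (@adj_zero_not_excited _ (y q)).
  rewrite !yE qp (_ : q + 1 <= p); last by lia.
  by rewrite (_ : q - t%:Z = q + 1 - t%:Z - 1); [apply: xR|]; lia.
rewrite gh_shift_right.
- by rewrite yE (_ : (q + 1 <= p) = false); [congr x|]; lia.
- rewrite !yE (_ : (q + 1 <= p) = false) ?qp; last by lia.
  by rewrite addrAC; apply: xL; lia.
(* If p + 1 is at 0, the state of p is e + r + 1 minus the step, which exceeds e because the step is
   at most r. *)
have [->|qp'] := eqVneq q (p + 1).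
  move=> y0; move: yC (ltn_ord (y p)); rewrite (_ : p + 1 - 1 = p); last by lia.
  by rewrite y0 /excited leqn0; case: eqP; lia.
apply: (@adj_zero_not_excited _ (y q)).
rewrite !yE qp (_ : (q - 1 <= p) = false); last by lia.
by rewrite (_ : q + t%:Z = q - 1 + t%:Z + 1); [apply: xL|]; lia.
Qed.

End CPi.

(** The counter is updated from its previous value and the new letter alone, so it can be part of
    the state in a graph of columns. The letter at time 0 is not counted. *)
Fixpoint zero_run (c : nat -> nat) t : nat :=
  if t is t'.+1 then if c t == 0%N then (zero_run c t').+1 else 0%N else 0%N.

Lemma zero_run_zero c t j : (j < zero_run c t)%N -> (j < t)%N /\ c (t - j)%N = 0%N.
Proof.
elim: t j => [//|t IHt] [|j] /=; case: eqP => // ct.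
by rewrite ltnS => /IHt[jt cj]; rewrite subSS.
Qed.

Lemma zero_run_bounded c K t :
  (forall u, exists2 j, (j <= K)%N & c (u + j)%N != 0%N) -> (zero_run c t <= K)%N.
Proof.
move=> cK; rewrite leqNgt; apply/negP => Kz.
have [Kt _] := zero_run_zero Kz.
have [j jK /eqP] := cK (t - K)%N; apply.
have Kj : (K - j < zero_run c t)%N by lia.
have [_ <-] := zero_run_zero Kj.
by congr c; lia.
Qed.

(* The last inequality says 0 <= mu ^ K * (mu ^ m.+1 - mu ^ m - 1) + 1, whose
   right-hand side is 1 at rho. *)
Lemma growth_rate_gap (R : realType) (rho : R) m K : 1 < rho ->
    rho ^+ m.+1 = rho ^+ m + 1 ->
  exists mu, [/\ 1 < mu, mu < rho &
    mu ^+ K.+1 - mu <= (mu - 1) * mu ^+ (K + m).+1].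
Proof.
move=> rho1 rhoE; pose p : {poly R} := 'X^K * ('X^(m.+1) - 'X^m - 1) + 1.
have pE x : p.[x] = x ^+ K * (x ^+ m.+1 - x ^+ m - 1) + 1 by rewrite !hornerE.
have p1 : p.[rho] = 1 by rewrite pE rhoE; ring.
have [d /= d0 dP] : exists2 d : R, 0 < d & forall x, `|rho - x| < d -> 0 < p.[x].
  have /cvgrPdist_lt/(_ _ ltr01)[d d0 dP] := @continuous_horner R p rho.
  exists d => // x /dP; rewrite p1 ltr_norml; lra.
pose h := Num.min d (rho - 1) / 2.
have h0 : 0 < h by rewrite divr_gt0// lt_min d0 subr_gt0.
have hd : h < d.
  by rewrite /h ltr_pdivrMr// gt_min; apply/orP; left; lra.
have hrho : h < rho - 1.
  by rewrite /h ltr_pdivrMr// gt_min; apply/orP; right; lra.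
exists (rho - h); split; [lra|lra|].
have : 0 < p.[rho - h] by apply: dP; rewrite opprB addrCA subrr addr0 gtr0_norm.
rewrite pE; set mu := rho - h.
have mu0 : 0 < mu by rewrite /mu; lra.
have -> : (mu - 1) * mu ^+ (K + m).+1 =
    mu * (mu ^+ K * (mu ^+ m.+1 - mu ^+ m - 1) + 1) + mu ^+ K.+1 - mu.
  by rewrite !exprS exprD; ring.
move=> pmu; rewrite lerB// lerDr mulr_ge0//; exact: ltW.
Qed.

(** * Upper bound for [Omega_var] *)

Section OmegaVarUpper.
Context {e r : nat}.
Hypothesis (e0 : (0 < e)%N) (r0 : (0 < r)%N).
Implicit Types (x y : config e r) (p q : int) (n k t : nat).
Local Notation A := 'I_(e + r).+1.

(** Both half-lines are merely shifted, so the times from u to u + K at one site, with K =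
    [#|C_pi e r|], read K + 1 consecutive sites of x in one half-line, where runs of zeros are
    bounded by K. *)
Lemma Omega_var_column (R : realType) x q : Omega_var x ->
  forall u, exists2 j, (j <= #|C_pi e r|)%N & iter (u + j) gh x q != 0%N :> nat.
Proof.
move=> [p _ [/Omega_step_C_pi Ox _ /(Ox e0 r0 R) stepC [xR zR] [xL zL]]] u.
have iterE := iter_gh_C_pi e0 r0 xR xL (fun m _ => stepC m).
move: #|C_pi e r| zR zL => K zR zL.
apply: contrapT => no.
have zero j : (j <= K)%N -> iter (u + j) gh x q = ord0.
  move=> jK; apply/val_inj/eqP; apply: contrapT => /negP xj.
  by apply: no; exists j.
move: zero; have [qp|pq] := lerP q p => zero.
  apply: (zR (q - (u + K)%:Z)); first by lia.
  move=> j /andP[lej ltj]; pose i := absz (q - u%:Z - j)%R.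
  have := zero i; rewrite iterE qp.
  by rewrite (_ : q - (u + i)%:Z = j) => [-> //|]; rewrite /i; lia.
apply: (zL (q + u%:Z)); first by lia.
move=> j /andP[lej ltj]; pose i := absz (j - q - u%:Z)%R.
have := zero i; rewrite iterE leNgt pq /=.
rewrite (_ : q + (u + i)%:Z = j) => [-> //|]; rewrite /i; lia.
Qed.

Lemma htop_Omega_var_le (R : realType) (mu : R) K : #|C_pi e r| = K -> 1 < mu ->
    mu ^+ K.+1 - mu <= (mu - 1) * mu ^+ (K + (e + r)).+1 ->
  (htop R (@Omega_var e r) <= (2 * ln mu)%:E)%E.
Proof.
move=> KE mu1 muP; have mu0 : 0 < mu by lra.
pose E (u v : A * 'I_K.+1) := adj u.1 v.1 &&
  (v.2 == (if v.1 == 0%N :> nat then u.2.+1 else 0%N) :> nat).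
(* Perron weights for the graph whose states also count the current zeros, up to
   K; muP is the only inequality that is not an equality, needed on leaving e + r. *)
pose wt (u : A * 'I_K.+1) : R :=
  if u.1 == 0%N :> nat then mu ^+ K.+1 - mu ^+ u.2 else (mu - 1) * mu ^+ (K + u.1).
have wt_ge u : mu - 1 <= wt u.
  have pow1 k : 1 <= mu ^+ k by rewrite exprn_ege1// ltW.
  rewrite /wt; case: ifP => _; last by rewrite ler_peMr// subr_ge0 ltW.
  have : mu ^+ u.2 <= mu ^+ K.
    by apply: ler_weXn2l; [exact: ltW|have := ltn_ord u.2; rewrite ltnS].
  have : mu - 1 <= (mu - 1) * mu ^+ K by rewrite ler_peMr// subr_ge0 ltW.
  rewrite exprS; lra.
have wt0 u : 0 <= wt u by apply: le_trans (wt_ge u); lra.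
pose run x q t := zero_run (fun t => iter t gh x q) t.
have runK x q t : Omega_var x -> (run x q t < K.+1)%N.
  move=> Ox; rewrite ltnS; apply: zero_run_bounded; rewrite -KE.
  exact: Omega_var_column.
apply: (@htop_le_columns _ _ _ _ E fst
  (fun x q t => (iter t gh x q : A, inord (run x q t))) _ wt _ mu _ _ wt_ge).
- exact: ltW.
- by rewrite subr_gt0.
- move=> [i z].
  pose zs : seq (A * 'I_K.+1) := if (z < K)%N then [:: (ord0, inord z.+1)] else [::].
  pose s := if i == 0%N :> nat then (inord 1, ord0) :: zs
    else if i == (e + r)%N :> nat then zs else [:: (inord i.+1, ord0)].
  apply: (@le_trans _ _ (\sum_(u <- s) wt u)).
    apply: sum_le_seq => // -[j w]; rewrite /E adjE//= => /andP[].
    have ltz := ltn_ord z; have ltw := ltn_ord w; have lti := ltn_ord i.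
    have inzs : j = 0%N :> nat -> w = z.+1 :> nat -> (j, w) \in zs.
      move=> j0 wz; rewrite /zs ifT ?inE; last by lia.
      by rewrite xpair_eqE -!val_eqE /= inordK ?j0 ?wz ?eqxx//; lia.
    rewrite /s; case: eqP => i0.
      rewrite leq_eqVlt ltnS leqn0 inE => /orP[/eqP j1|/eqP j0].
        rewrite j1 /= => /eqP w0.
        by rewrite xpair_eqE -!val_eqE /= inordK ?j1 ?w0 ?eqxx //=; lia.
      by rewrite j0 /= => /eqP wz; rewrite inzs ?orbT.
    case: eqP => ier; first by move=> /eqP j0; rewrite j0 /= => /eqP; exact: inzs.
    move=> /eqP ji; rewrite ji /= => /eqP w0.
    rewrite inE xpair_eqE -!val_eqE /= inordK ?ji ?w0 ?eqxx//; lia.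
  have zsE : \sum_(u <- zs) wt u = if (z < K)%N then mu ^+ K.+1 - mu ^+ z.+1 else 0.
    rewrite /zs; case: ifP => zK; last by rewrite big_nil.
    by rewrite big_seq1 /wt /= inordK.
  have zK : (z <= K)%N by rewrite -ltnS.
  have lti := ltn_ord i.
  rewrite /s; case: eqP => i0.
    rewrite big_cons zsE /wt /= inordK ?i0 /=; last by lia.
    rewrite addn1 mulrBr -!exprS mulrBl mul1r -exprS; case: ltnP => [|Kz].
      by lra.
    (* At z = K the list [zs] is empty, in accordance with [mu ^+ K.+1 - mu ^+ z.+1], which vanishes
       there. *)
    by rewrite (_ : z = K :> nat); [lra|lia].
  case: eqP => ier.
    have er0 : (e + r == 0)%N = false by move: e0; lia.
    rewrite zsE /wt /= ier er0.
    rewrite mulrCA -exprS; case: ifP => _; last first.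
      by rewrite mulr_ge0 ?exprn_ge0 ?subr_ge0// ltW.
    apply: le_trans muP; rewrite lerD2l lerN2.
    by rewrite exprS ler_peMr ?exprn_ege1// ltW.
  rewrite big_seq1 /wt /= inordK /=; last by lia.
  by rewrite (introF eqP i0) addnS exprS mulrCA.
- move=> x q t Ox; rewrite /E /= gh_adj//= !inordK; [|exact: runK..].
  by rewrite /run /=.
- by [].
Qed.

End OmegaVarUpper.

Lemma modn_succ m u :
  (u.+1 %% m.+1 = if u %% m.+1 == m then 0 else (u %% m.+1).+1)%N.
Proof.
rewrite modnS; have := ltn_pmod u (ltn0Sn m) => ltu.
rewrite -[u.+1]addn1 /dvdn -modnDml; have [->|um] := eqVneq (u %% m.+1)%N m.
  by rewrite addn1 modnn.
by rewrite modn_small ?addn1//; lia.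
Qed.

(** * Pulse collisions *)

Section Lifts.
Context {e r : nat}.
Hypothesis (e0 : (0 < e)%N) (r0 : (0 < r)%N).
Implicit Types (x : config e r) (p q z : int) (n t : nat) (F G : int -> nat).
Local Notation a := (e + r).+1.

(** The height counts the advances of a site: its residue modulo [a] is the state, and rests happen
    in state 0 only. *)
Definition lift_step (u v : nat) : Prop := v = u.+1 \/ v = u /\ (a %| u)%N.

Definition is_lift F : Prop := forall z, lift_step (F z) (F (z + 1)).

(* The lifted height of a collision is the maximum of the two incoming waves, and
   gh_pulses says that the waves evolve without interaction. *)
Definition pulses F G : config e r :=
  fun q => inord (maxn (F (- q)) (G q) %% a)%N.

Lemma pulses_val F G q : pulses F G q = (maxn (F (- q)) (G q) %% a)%N :> nat.
Proof. by rewrite inordK// ltn_mod. Qed.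

Lemma lift_step_le u v : lift_step u v -> (u <= v <= u.+1)%N.
Proof. by case=> [->|[-> _]]; rewrite ?leqnSn ?leqnn. Qed.

Lemma lift_stepN u v : lift_step u v -> ~~ (a %| u)%N -> v = u.+1.
Proof. by case=> [//|[_ ->]]. Qed.

(** If the maximum M of the middle heights is not a multiple of [a], the higher wave must advance.
    If it is, a wave that reaches M + 1 already shows this height, of excited state 1, at a
    neighbour. If neither does, both neighbours have heights M - 1 or M, whose states are e + r or 0
    and not excited. *)
Lemma lift_step_max f f' f'' g g' g'' :
    lift_step f f' -> lift_step f' f'' -> lift_step g g' -> lift_step g' g'' ->
  (maxn f'' g'' %% a)%N =
  (let u := maxn f' g' %% a in
   if u == 0 then nat_of_bool ((0 < maxn f'' g %% a <= e) || (0 < maxn f g'' %% a <= e))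
   else if u == e + r then 0 else u.+1)%N.
Proof.
move=> ff ff' gg gg'; rewrite /=; set M := maxn f' g'.
have [ffl ffl'] := (lift_step_le ff, lift_step_le ff').
have [ggl ggl'] := (lift_step_le gg, lift_step_le gg').
have [aM|aM] := boolP (a %| M)%N; last first.
  rewrite ifF; last by apply/negbTE.
  rewrite -modn_succ; congr (_ %% _)%N.
  have [fg|gf] := leqP f' g'.
    by have := lift_stepN gg'; rewrite -(maxn_idPr fg) -/M => /(_ aM); lia.
  by have := lift_stepN ff'; rewrite -(maxn_idPl (ltnW gf)) -/M => /(_ aM); lia.
have M0 : (M %% a = 0)%N by apply/eqP.
have M1 : (M.+1 %% a = 1)%N by rewrite modn_succ M0; case: eqP => //; lia.
have quiet u : (M.-1 <= u <= M)%N -> (0 < u %% a <= e)%N = false.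
  move=> uM; have [->|->] : u = M \/ u = M.-1 by lia.
    by rewrite M0.
  have [->|Mpos] := posnP M; first by rewrite mod0n.
  have := modn_succ (e + r) M.-1; rewrite prednK// M0; case: eqP => [->|] //; lia.
rewrite M0 eqxx; clear ff ff' gg gg'.
have [fM|fM] := eqVneq f'' M.+1.
  rewrite (_ : maxn f'' g'' = M.+1); last by lia.
  rewrite (_ : maxn f'' g = M.+1); last by lia.
  by rewrite M1 e0.
have [gM|gM] := eqVneq g'' M.+1.
  rewrite (_ : maxn f'' g'' = M.+1); last by lia.
  rewrite (_ : maxn f g'' = M.+1); last by lia.
  by rewrite M1 e0 orbT.
rewrite (_ : maxn f'' g'' = M) ?M0; last by lia.
by rewrite !quiet//; lia.
Qed.

Lemma gh_pulses F G : is_lift F -> is_lift G ->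
  gh (pulses F G) = pulses (fun z => F (z + 1)) (fun z => G (z + 1)).
Proof.
move=> liftF liftG; apply/funext => q; apply/val_inj.
rewrite /= gh_val// /excited !pulses_val.
rewrite (_ : - (q - 1) = - q + 1); last by lia.
have := @lift_step_max (F (- (q + 1))) (F (- q)) (F (- q + 1))
  (G (q - 1)) (G q) (G (q + 1)).
move=> -> //.
- by have := liftF (- (q + 1)); rewrite (_ : - (q + 1) + 1 = - q); last lia.
- by have := liftG (q - 1); rewrite subrK.
Qed.

Lemma iter_gh_pulses F G t q : is_lift F -> is_lift G ->
  iter t gh (pulses F G) q = (maxn (F (t%:Z - q)%R) (G (q + t%:Z)%R) %% a)%N :> nat.
Proof.
move=> liftF liftG; suff -> : iter t gh (pulses F G) =
    pulses (fun z => F (z + t%:Z)) (fun z => G (z + t%:Z)).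
  by rewrite pulses_val addrC.
elim: t => [|t /= ->].
  by congr pulses; apply/funext => z; rewrite addr0.
rewrite gh_pulses; last 2 first.
- by move=> z; rewrite addrAC; exact: liftF.
- by move=> z; rewrite addrAC; exact: liftG.
by congr pulses; apply/funext => z; [congr F|congr G]; lia.
Qed.

Lemma lift_adj F z (u v : 'I_a) : is_lift F -> u = (F z %% a)%N :> nat ->
  v = (F (z + 1)%R %% a)%N :> nat -> adj u v.
Proof.
move=> liftF uF vF; rewrite adjE// vF; move: (liftF z).
have -> : (u == 0%N :> nat) = (a %| F z)%N by rewrite uF.
have [aF|aF] := boolP (a %| F z)%N; last first.
  by move=> /lift_stepN/(_ aF) ->; rewrite modn_succ -uF; case: eqP.
case=> [->|[-> _]]; rewrite ?modn_succ (eqP aF) //.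
by case: ifP.
Qed.

(** A site violating [S_R] bounds the separating positions from the right, so there is a largest
    one; it is at least p and inherits the condition on the right half-line from p. *)
Lemma S_Rm_S_Lp_Z x p : S_Rm p x -> S_Lp p x -> Z x.
Proof.
move=> xR xL; have [SRL|nSRL] := pselect ((@S_R e r `|` @S_L e r) x).
  by left.
have Ip : I_sp x p by split=> // i pi; apply: xL; lia.
have [i iP] : exists i, ~ adj (x i) (x (i - 1)).
  by apply/existsNP => SR; apply: nSRL; left.
have Ilt q : I_sp x q -> q < i.
  by move=> [qR _]; rewrite ltNge; apply/negP => iq; apply: iP; exact: qR.
pose P (n : nat) := `[< I_sp x (p + n%:Z) >].
have exP : exists n, P n by exists 0%N; apply/asboolP; rewrite addr0.
have ubP n : P n -> (n <= absz (i - p)%R)%N by move=> /asboolP/Ilt; lia.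
have [n /asboolP In maxn] := ex_maxnP exP ubP.
right; split; first by split=> //; exists p.
exists (p + n%:Z); split=> // [q Iq|].
  have [pq|qp] := lerP p q; last by lia.
  have /maxn : P (absz (q - p)%R).
    by apply/asboolP; rewrite (_ : p + _ = q)//; lia.
  by lia.
right; split; first by case: In.
by move=> j pj; apply: xL; lia.
Qed.

(** On each half-line one wave vanishes and the other is visible; both describe site 0, so
    [S_Rm_S_Lp_Z] applies there. *)
Lemma pulses_Z F G : is_lift F -> is_lift G ->
  (forall z, z <= 0 -> F z = 0%N) -> (forall z, z <= 0 -> G z = 0%N) ->
  Z (pulses F G).
Proof.
move=> liftF liftG F0 G0; apply: (@S_Rm_S_Lp_Z _ 0) => i i0.
  apply: (lift_adj (z := - i) liftF); rewrite pulses_val; last first.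
    by rewrite (G0 (i - 1)) ?maxn0 ?opprD ?opprK//; lia.
  by rewrite (G0 i) ?maxn0//; lia.
apply: (lift_adj (z := i) liftG); rewrite pulses_val; last first.
  by rewrite (F0 (- (i + 1))) ?max0n//; lia.
by rewrite (F0 (- i)) ?max0n//; lia.
Qed.

End Lifts.

(** * Counting lifted histories *)

Section Heights.
Variable m : nat.
Local Notation a := m.+1.

(* Lifted histories of a single site over n steps, from height h: the state is the
   height modulo a, and resting is allowed at multiples of a only. *)
Fixpoint heights n h : seq (seq nat) :=
  if n is n'.+1 then
    [seq h :: w | w <- heights n' h.+1 ++ if (a %| h)%N then heights n' h else [::]]
  else [:: [:: h]].

Lemma heightsP n h w : w \in heights n h ->
  [/\ size w = n.+1, nth 0%N w 0 = h,
      forall s, (s < n)%N -> nth 0%N w s.+1 = (nth 0%N w s).+1 \/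
        nth 0%N w s.+1 = nth 0%N w s /\ (a %| nth 0%N w s)%N
    & (nth 0%N w n <= h + n)%N].
Proof.
elim: n h w => [|n IHn] h w.
  by rewrite inE => /eqP ->; split=> //=; rewrite addn0.
move=> /mapP[v + ->]; rewrite mem_cat => vP.
have [h' [hh' /IHn[sv v0 vs vn]]] : exists h',
    (h' = h.+1 \/ h' = h /\ (a %| h)%N) /\ v \in heights n h'.
  case/orP: vP => [vP|]; first by exists h.+1; split=> //; left.
  by case: ifP => // ah vP; exists h; split=> //; right.
split=> [||[|s] sn|] /=.
- by rewrite sv.
- by [].
- by rewrite v0.
- exact: vs.
- by case: hh' => [|[]]; lia.
Qed.

Lemma heights_uniq n h : uniq (heights n h).
Proof.
elim: n h => [//|n IHn] h /=; rewrite map_inj_uniq; last by move=> u v [].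
rewrite cat_uniq IHn /=; case: ifP => _ /=; last by [].
rewrite IHn andbT; apply/hasPn => w /heightsP[_ wh _ _]; apply/negP.
by move=> /heightsP[_ wh' _ _]; lia.
Qed.

(** Here [wt] is the Perron eigenvector of the state graph, with eigenvalue [rho]. Its largest entry
    [rho ^+ a] belongs to state 0, so a start at height 0 loses no constant factor. *)
Lemma size_heights_ge (R : realType) (rho : R) n : (0 < m)%N -> 1 < rho ->
  rho ^+ a = rho ^+ m + 1 -> rho ^+ n <= (size (heights n 0))%:R.
Proof.
move=> m0 rho1 rhoE; have rho0 : 0 < rho by lra.
pose wt h := if (a %| h)%N then rho ^+ a else rho ^+ (h %% a)%N.
suff main h : rho ^+ n * wt h <= rho ^+ a * (size (heights n h))%:R.
  have := main 0%N; rewrite /wt dvdn0 mulrC ler_pM2l//; exact: exprn_gt0.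
elim: n h => [|n IHn] h.
  rewrite mul1r mulr1 /wt; case: ifP => // _.
  by apply: ler_weXn2l; [exact: ltW|rewrite ltnW ?ltn_mod].
rewrite /= size_map size_cat natrD mulrDr exprSr -mulrA.
apply: (@le_trans _ _ (rho ^+ n * (wt h.+1 + if (a %| h)%N then wt h else 0))).
  rewrite ler_wpM2l ?exprn_ge0 ?(ltW rho0)// /wt /dvdn modn_succ.
  have [->|hm] := eqVneq (h %% a)%N m.
    by rewrite eqxx (gtn_eqF m0) addr0 -exprS.
  have -> : ((h %% a).+1 == 0)%N = false by [].
  case: eqP => [->|_]; last by rewrite addr0 -exprS.
  by rewrite [rho ^+ a in leLHS]rhoE mulrDr mulr1 -exprS expr1 addrC.
rewrite mulrDr lerD//; case: ifP => _; first exact: IHn.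
by rewrite !mulr0.
Qed.

(** Words with a common final height can be completed to blocks of equal length and equal height;
    selecting them costs only the factor [n.+1]. *)
Lemma pigeonhole_last n (s : seq (seq nat)) :
    (forall w, w \in s -> (nth 0%N w n <= n)%N) ->
  exists h, (size s <= n.+1 * size [seq w <- s | nth 0%N w n == h :> nat])%N.
Proof.
move=> sn; pose c (h : 'I_n.+1) := size [seq w <- s | nth 0%N w n == h :> nat].
have [|h hmax] := bigop.eq_bigmax c; first by rewrite card_ord.
exists h; apply: (@leq_trans (\sum_i c i)%N).
  rewrite /c; clear -sn; elim: s sn => [//|w s IHs] sn.
  have wn : (nth 0%N w n < n.+1)%N by rewrite ltnS sn ?mem_head.
  rewrite (bigD1 (Ordinal wn))//= eqxx /= addSn ltnS.
  apply: leq_trans (IHs _) _; first by move=> v vs; apply: sn; rewrite inE vs orbT.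
  rewrite (bigD1 (Ordinal wn))//= leq_add2l leq_sum// => i _.
  by case: ifP => //= _; exact: leqnSn.
rewrite -[X in (X * _)%N]card_ord -sum_nat_const leq_sum// => i _.
by rewrite -/(c h) -hmax; exact: leq_bigmax.
Qed.

End Heights.

#[local] Arguments is_lift : clear implicits.
#[local] Arguments lift_step : clear implicits.

(** * Concatenated waves and the entropy of [Z] *)

Section Blocks.
Context {e r : nat}.
Hypothesis (e0 : (0 < e)%N) (r0 : (0 < r)%N).
Local Notation a := (e + r).+1.
Implicit Types (n s i k h L : nat) (w v : seq nat).

Definition block L k (f : nat -> nat) : Prop :=
  [/\ f 0%N = 0%N, f L = (a * k)%N & forall s, (s < L)%N -> lift_step e r (f s) (f s.+1)].

(** Raising block i by [a * k * i] changes neither its states nor the places where it may rest. *)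
Definition chain L k (b : nat -> nat -> nat) (z : int) : nat :=
  if z is Posz n then (a * k * (n %/ L) + b (n %/ L) (n %% L))%N else 0%N.

Section Chain.
Variables (L k : nat) (b : nat -> nat -> nat).
Hypothesis (L0 : (0 < L)%N) (bP : forall i, block L k (b i)).

Lemma chain_at i s : (s <= L)%N -> chain L k b (i * L + s)%N%:Z = (a * k * i + b i s)%N.
Proof.
rewrite leq_eqVlt /chain => /predU1P[->|sL]; last first.
  by rewrite divnMDl// modnMDl divn_small// modn_small// addn0.
rewrite -mulSnr mulnK// modnMl; have [-> _ _] := bP i.+1.
by have [_ -> _] := bP i; rewrite addn0 mulnS addnC.
Qed.

Lemma chain0 z : z <= 0 -> chain L k b z = 0%N.
Proof.
case: z => [[|n]|n] // _; rewrite -[0%N]/(0 * L + 0)%N chain_at//.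
by have [-> _ _] := bP 0%N; rewrite muln0.
Qed.

Lemma chain_lift : is_lift e r (chain L k b).
Proof.
move=> z; have [z0|z0] := ltrP z 0.
  by rewrite !chain0; [right|lia|lia].
have -> : z = (absz z %/ L * L + absz z %% L)%N%:Z by rewrite -divn_eq; lia.
set i := (_ %/ _)%N; set s := (_ %% _)%N.
have sL : (s < L)%N by rewrite ltn_mod.
rewrite -PoszD -addnA addn1 !chain_at// ?(ltnW sL)//.
have [_ _ /(_ s sL)[->|[-> as']]] := bP i; [left|right].
  by rewrite addnS.
by split=> //; rewrite dvdn_add// -mulnA dvdn_mulr.
Qed.

End Chain.

Lemma lift_le F (z z' : int) : is_lift e r F -> z <= z' -> (F z <= F z')%N.
Proof.
move=> liftF zz'; rewrite (_ : z' = z + (absz (z' - z)%R)%:Z); last by lia.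
elim: (absz _) => [|n IHn]; first by rewrite addr0.
apply: leq_trans IHn _; rewrite -addn1 PoszD addrA.
by case/andP: (lift_step_le (liftF (z + n%:Z))).
Qed.

(** After its n steps the word climbs to the next multiple of [a] and rests there. The climb takes
    fewer than [a] steps, so length [n + a] always suffices and the end depends on the final height
    alone. *)
Definition pad n w s : nat :=
  if (s <= n)%N then nth 0%N w s
  else minn (nth 0 w n + (s - n))%N (a * ((nth 0 w n + (e + r)) %/ a))%N.

Lemma pad_block n h w : w \in heights (e + r) n 0 -> nth 0%N w n = h ->
  block (n + a) ((h + (e + r)) %/ a)%N (pad n w).
Proof.
move=> wn wh; have [_ w0 ws _] := heightsP wn.
rewrite /pad wh; set k := ((h + (e + r)) %/ a)%N.
have := divn_eq (h + (e + r)) a; rewrite -/k mulnC => kE.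
have := ltn_pmod (h + (e + r)) (ltn0Sn (e + r)) => rem_lt.
have tail s : (n <= s)%N -> (if s <= n then nth 0 w s else
    minn (h + (s - n)) (a * k))%N = minn (h + (s - n)) (a * k).
  by move=> ns; case: leqP => // sn; rewrite (_ : s = n) ?wh; lia.
split; first by rewrite leq0n.
  by rewrite tail; lia.
move=> s sL; have [sn|ns] := ltnP s n.
  by rewrite (ltnW sn); exact: ws.
rewrite (tail _ ns).
have [lt|ge] := ltnP (h + (s - n)) (a * k); first by left; lia.
by right; split; [lia|exact: dvdn_mulr].
Qed.

(** Increments are 0 or 1, which differ modulo [a], so the residues determine the heights. *)
Lemma heights_modn_inj n w v : w \in heights (e + r) n 0 ->
    v \in heights (e + r) n 0 ->
    (forall s, (s <= n)%N -> nth 0%N w s = nth 0%N v s %[mod a]) ->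
  w = v.
Proof.
move=> /heightsP[sw w0 ws _] /heightsP[sv v0 vs _] wv.
apply: (@eq_from_nth _ 0%N) => [|s]; rewrite sw ?sv// ltnS => sn.
elim: s sn => [_|s IHs sn]; first by rewrite w0 v0.
have {}IHs := IHs (ltnW sn); have := wv _ sn.
have neq u : u.+1 = u %[mod a] -> False.
  by rewrite modn_succ; case: eqP => [->|_]; lia.
case: (ws _ sn) => [->|[-> _]]; case: (vs _ sn) => [->|[-> _]] //;
  rewrite IHs //; [by move/neq|by move/esym/neq].
Qed.

Lemma dist_gt (R : realType) (x y : config e r) (k q : int) :
  `|q| <= k -> x q <> y q -> 2 ^ (- k) <= dist R x y.
Proof.
move=> qk xyq; rewrite leNgt; apply/negP => /ltW/dist_le xy.
by apply: xyq; exact: xy.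
Qed.

Lemma dist_refl (R : realType) (x : config e r) : dist R x x = 0.
Proof. by rewrite /dist asboolT. Qed.

(* All the chains below have height a * k * i at time i * L, so that the two
   waves stay balanced and the pulses annihilate within [-L, L]; the i-th blocks
   are therefore seen around the origin at time i * L. *)
Lemma htop_ge_Z (R : realType) (rho : R) (M : set (config e r)) n :
    @Z e r `<=` M -> 1 < rho -> rho ^+ a = rho ^+ (e + r) + 1 ->
  exists N, [/\ (0 < N)%N, rho ^+ n <= (n.+1 * N)%:R &
    ((ln (N ^ 2)%:R / (n + a)%:R)%:E <= htop R M)%E].
Proof.
move=> ZM rho1 rhoE.
have [h hP] : exists h, (size (heights (e + r) n 0) <=
    n.+1 * size [seq w <- heights (e + r) n 0 | nth 0%N w n == h])%N.
  by apply: pigeonhole_last => w /heightsP[].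
set W := [seq w <- _ | _] in hP.
have rhoW : rho ^+ n <= (n.+1 * size W)%:R.
  apply: le_trans (size_heights_ge n _ rho1 rhoE) _; first by lia.
  by rewrite ler_nat.
have W0 : (0 < size W)%N.
  rewrite lt0n; apply/eqP => W0; move: rhoW; rewrite W0 muln0 leNgt.
  by rewrite exprn_gt0//; lra.
exists (size W); split=> //; set L := (n + a)%N; pose k := ((h + (e + r)) %/ a)%N.
have L0 : (0 < L)%N by rewrite /L addnS.
have WP i : (i < size W)%N -> nth [::] W i \in heights (e + r) n 0 /\
    nth 0%N (nth [::] W i) n = h.
  by move=> /(mem_nth [::]); rewrite mem_filter => /andP[/eqP].
apply: (@entropy_ge _ _ _ _ _ (2 ^ (- L%:Z))) => //.
  by rewrite expn_gt0 W0.
move=> q q0.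
(* The flag c selects the wave and i the block; from block q on, the word of index 0 is repeated. *)
pose idx (f : {ffun 'I_q * bool -> 'I_(size W)}) c i : nat :=
  if insub i is Some j then f (j, c) else 0%N.
have idxW f c i : (idx f c i < size W)%N by rewrite /idx; case: insubP.
pose b f c i := pad n (nth [::] W (idx f c i)).
have bP f c i : block L k (b f c i) by have [] := WP _ (idxW f c i); exact: pad_block.
pose psi f : config e r := pulses (chain L k (b f false)) (chain L k (b f true)).
have liftb f c : is_lift e r (chain L k (b f c)) by exact: chain_lift.
have -> : ((size W ^ 2) ^ q)%N = #|{ffun 'I_q * bool -> 'I_(size W)}|.
  by rewrite card_ffun card_prod card_bool !card_ord -expnM mulnC.
apply: (@sep_card_ge_family _ _ _ _ _ psi).
- move=> f; apply/ZM/pulses_Z => // z z0.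
  + exact: chain0 L0 (bP f false) _ z0.
  + exact: chain0 L0 (bP f true) _ z0.
- exact: exprz_gt0.
- move=> f g fg.
  have [[i c] fgi] : exists ic, f ic != g ic.
    apply/existsP; apply: contraNT fg; rewrite negb_exists => /forallP fg.
    by apply/eqP/ffunP => ic; apply/eqP; rewrite -[_ == _]negbK.
  have idxE f' : idx f' c i = f' (i, c).
    by rewrite /idx insubT//= => ip; congr (nat_of_ord (f' (_, _))); apply/val_inj.
  have [s sn fgs] : exists2 s, (s <= n)%N & b f c i s != b g c i s %[mod a].
    apply: contrapT => no; move: fgi; rewrite -val_eqE /= -!idxE.
    rewrite -(nth_uniq [::] (idxW f c i) (idxW g c i)); last first.
      exact/filter_uniq/heights_uniq.
    move=> /eqP; apply; apply: (@heights_modn_inj n).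
    + by have [] := WP _ (idxW f c i).
    + by have [] := WP _ (idxW g c i).
    move=> s sn; apply: contrapT => fgs; apply: no; exists s => //.
    by apply/eqP; rewrite /b /pad sn.
  exists (i * L)%N; first by rewrite ltn_pmul2r.
  have sL : (s <= L)%N by rewrite (leq_trans sn) ?leq_addr.
  (* the wave moving from the other side is still behind at site -+ s *)
  have val f' : iter (i * L) gh (psi f') (if c then s%:Z else - s%:Z) =
      (b f' c i s %% a)%N :> nat.
    have top c' : chain L k (b f' c') (i * L)%N%:Z = (a * k * i)%N.
      rewrite -[(i * L)%N]addn0 chain_at//.
      by have [-> _ _] := bP f' c' i; rewrite addn0.
    have far c' : (chain L k (b f' c') ((i * L)%N%:Z - s%:Z)%R <=
        chain L k (b f' (~~ c')) (i * L + s)%N%:Z)%N.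
      apply: (@leq_trans (a * k * i)%N).
        by rewrite -(top c'); apply: lift_le => //; lia.
      by rewrite -(top (~~ c')); apply: lift_le => //; lia.
    have val_at c' : (chain L k (b f' c') (i * L + s)%N%:Z %% a)%N = (b f' c' i s %% a)%N.
      by rewrite chain_at// -mulnA mulnC modnMDl.
    rewrite iter_gh_pulses// -(val_at c); congr (_ %% _)%N; case: (c).
      rewrite (_ : s%:Z + _ = (i * L + s)%N%:Z); last by lia.
      exact: elimT maxn_idPr (far false).
    rewrite (_ : _ - - s%:Z = (i * L + s)%N%:Z); last by lia.
    rewrite (_ : - s%:Z + _ = (i * L)%N%:Z - s%:Z); last by lia.
    exact: elimT maxn_idPl (far true).
  have : iter (i * L) gh (psi f) (if c then s%:Z else - s%:Z) <>
      iter (i * L) gh (psi g) (if c then s%:Z else - s%:Z).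
    by move=> /(congr1 (@nat_of_ord _)); rewrite !val; apply/eqP.
  by apply: dist_gt; case: (c); lia.
- by move=> x; rewrite dist_refl exprz_gt0.
Qed.

Lemma htop_eq (R : realType) (rho : R) (M : set (config e r)) :
    @Z e r `<=` M -> 1 < rho -> rho ^+ a = rho ^+ (e + r) + 1 ->
  htop R M = (2 * ln rho)%:E.
Proof.
move=> ZM rho1 rhoE; have le_h := htop_le e0 r0 M rho1 rhoE.
have rho0 : 0 < rho by lra.
have h0 : (0 <= htop R M)%E by exact: entropy_ge0.
have [h hE] : exists h : R, htop R M = h%:E.
  exists (fine (htop R M)); rewrite fineK// fin_numElt.
  by rewrite (lt_le_trans _ h0) ?ltNyr// (le_lt_trans le_h) ?ltry.
move: le_h h0; rewrite hE !lee_fin => le_h h0; congr (_%:E).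
apply/eqP; rewrite eq_le le_h /= leNgt; apply/negP => lt_h.
pose delta := 2 * ln rho - h; have delta0 : 0 < delta by rewrite subr_gt0.
have bound k : (0 < k)%N -> k%:R * delta <= h * a%:R + delta + 4.
  move=> k0; have k1 : (1 : R) <= k%:R by rewrite ler1n.
  (* With [n.+1] equal to k ^ 2 the pigeonhole loss is of order ln k < k, whereas [delta] is
     multiplied by about k ^ 2; division by k leaves a bound linear in k. *)
  have [N [N0 rhoN]] := htop_ge_Z (k ^ 2).-1 ZM rho1 rhoE.
  rewrite hE lee_fin ler_pdivrMr ?ltr0n ?addnS//.
  rewrite natrX lnXn ?ltr0n// -addnS natrD => lnN.
  have := rhoN; rewrite prednK ?expn_gt0 ?k0// => {}rhoN.
  have {}rhoN : (k ^ 2).-1%:R * ln rho <= 2 * ln k%:R + ln N%:R.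
    have : ln (rho ^+ (k ^ 2).-1) <= ln (k ^ 2 * N)%:R.
      by rewrite ler_ln ?posrE ?exprn_gt0// ltr0n muln_gt0 expn_gt0 k0.
    by rewrite natrM natrX lnM ?posrE ?exprn_gt0 ?ltr0n// !lnXn ?ltr0n// -![ln _ *+ _]mulr_natl.
  have lnk : ln k%:R < k%:R :> R by apply: ln_sublinear; rewrite ltr0n.
  have k2 : (k ^ 2).-1%:R = k%:R * k%:R - 1 :> R.
    by rewrite -subn1 natrB ?expn_gt0 ?k0// natrX expr2.
  move: lnN rhoN; rewrite k2 -[ln _ *+ _]mulr_natl => lnN rhoN.
  have k0' : 0 < k%:R :> R by rewrite ltr0n.
  rewrite -(ler_pM2l k0').
  have h1 : 0 <= h * a%:R by rewrite mulr_ge0.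
  have h2 : (k%:R * k%:R - 1) * delta <= h * a%:R + 4 * k%:R by rewrite /delta; nra.
  nra.
have := truncnS_gt ((h * a%:R + delta + 4) / delta).
rewrite ltr_pdivrMr// => /lt_le_trans/(_ (bound _ (ltn0Sn _))).
by rewrite ltxx.
Qed.

End Blocks.

(** * Periodic points of Omega_var *)

Section OmegaVarLower.
Context {e r : nat}.
Hypothesis (e0 : (0 < e)%N) (r0 : (0 < r)%N) (er : (e + 1 < r)%N).
Local Notation a := (e + r).+1.
Implicit Types (n s i k t : nat).

Section Interface.
Variable c : nat -> nat.
Hypothesis (c_lt : forall t, (c t < a)%N).
Hypothesis (c_step : forall t, c t.+1 = (c t).+1 \/
  (c t = 0 /\ c t.+1 = 0 \/ c t = e + r /\ c t.+1 = 0)%N).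
Hypothesis (c_zeros : forall t, c t = 0%N -> c t.+1 = 0%N -> c t.+2 <> 0%N).

(* Between two rests the site runs through a whole cycle. *)
Lemma window_one_rest t k : (k <= e + r)%N ->
  c (t + k) = ((c t + k) %% a)%N \/
  exists j, [/\ (j < k)%N, (a %| c t + j)%N, c (t + j) = 0%N, c (t + j).+1 = 0%N &
    c (t + k) = (k - j - 1)%N].
Proof.
elim: k => [_|k IHk ker]; first by left; rewrite !addn0 modn_small.
rewrite (addnS t k); have := c_lt (t + k).+1 => clt.
have [cA|[j [jk aj j0 j1 ck]]] := IHk (ltnW ker).
  case: (c_step (t + k)) => [cS|[[ct0 ct1]|[ct0 ct1]]].
  - by left; rewrite addnS modn_succ -cA; case: eqP; lia.
  - right; exists k; split=> //; last by rewrite ct1; lia.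
    by rewrite /dvdn -cA ct0.
  - by left; rewrite addnS modn_succ -cA ct0 eqxx.
right; exists j; split=> //; first exact: ltnW.
case: (c_step (t + k)) => [->|[[ct0 ct1]|[ct0 ct1]]]; [lia| |lia].
have kj : (t + k = (t + j).+1)%N by lia.
by case: (c_zeros j0 j1); rewrite -ct1 kj.
Qed.

Lemma window_step t k : (0 < k <= e + r)%N ->
  ((if c t <= c (t + k) then c (t + k) - c t else c (t + k) + a - c t) = k \/
   (if c t <= c (t + k) then c (t + k) - c t else c (t + k) + a - c t) = k.-1)%N.
Proof.
move=> /andP[k0 ker]; have := c_lt t => ltc.
have [->|[j [jk aj _ _ ->]]] := window_one_rest t ker.
  left; have [lt|ge] := ltnP (c t + k) a.
    by rewrite modn_small// leq_addr; lia.
  rewrite (_ : c t + k = c t + k - a + a)%N ?modnDr ?modn_small//; [|lia|lia].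
  by case: ifP; lia.
right; have : c t + j = 0 \/ c t + j = a.
  case/dvdnP: aj => u uE; case: u uE => [|[|u]] uE; [lia|lia|].
  by have : (a * 2 <= c t + j)%N; [rewrite uE mulnC leq_mul2r; lia|lia].
by case: ifP; lia.
Qed.

(* The right half-line carries the same wave as the left one, e + 2 steps ahead, so
   that the step at 0 alternates between e + 1 and e + 2. *)
Definition interface : config e r :=
  fun q => inord (if q <= 0 then c (absz q) else c (absz q + e + 1)%N).

Lemma interface_neg i : interface (- i%:Z) = c i :> nat.
Proof.
by rewrite /interface oppr_le0 lez_nat leq0n abszN inordK.
Qed.

Lemma interface_pos i : interface i.+1%:Z = c (i + (e + 2)) :> nat.
Proof. by rewrite /interface inordK//; congr c; lia. Qed.

Lemma c_adj (u v : 'I_a) t : u = c t :> nat -> v = c t.+1 :> nat -> adj u v.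
Proof.
move=> uE vE; rewrite adjE// uE vE; have := c_step t; have := c_lt t.+1.
by case: eqP; [|case: eqP]; lia.
Qed.

Lemma interface_S_Rm : S_Rm 0 interface.
Proof.
move=> q q0; have -> : q = - (absz q)%:Z by lia.
apply: (c_adj (t := absz q)); first exact: interface_neg.
by rewrite -interface_neg; congr (nat_of_ord (interface _)); lia.
Qed.

Lemma interface_S_Lp : S_Lp (0 + 1) interface.
Proof.
move=> q q0; have -> : q = (absz q).-1.+1%:Z by lia.
apply: (c_adj (t := (absz q).-1 + (e + 2))); first exact: interface_pos.
by rewrite -(addSn (absz q).-1) -interface_pos; congr (nat_of_ord (interface _)); lia.
Qed.

(** The lead is e + 2 or e + 1 by [window_step], and both lie in [C_pi] because r > e + 1. *)
Lemma in_C_pi (u v : 'I_a) t : u = c t :> nat -> v = c (t + (e + 2)) :> nat ->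
  v - u \in C_pi e r.
Proof.
move=> uE vE; rewrite inE ord_sub_val uE vE.
by have [] := @window_step t (e + 2); [lia|move=> ->|move=> ->]; lia.
Qed.

Lemma iter_interface t q : iter t gh interface q =
  interface (if q <= 0 then q - t%:Z else q + t%:Z).
Proof.
apply: iter_gh_C_pi => //; first exact: interface_S_Rm.
  exact: interface_S_Lp.
move=> m mE; apply: (in_C_pi (t := m)).
  by rewrite mE lexx sub0r interface_neg.
by rewrite mE /= -interface_pos; congr (nat_of_ord (interface _)); lia.
Qed.

Lemma interface_step m : step interface 0 m \in C_pi e r.
Proof.
apply: (in_C_pi (t := m)).
  by rewrite iter_interface lexx sub0r interface_neg.
by rewrite iter_interface /= -interface_pos; congr (nat_of_ord (interface _)); lia.
Qed.

(** While site 0 rests, a constant step would force site 1 to rest as well, hence in state 0; the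
    step would then be 0, which is not in [C_pi]. *)
Lemma interface_not_const t : c t = 0%N -> c t.+1 = 0%N -> ~ Omega_const interface.
Proof.
move=> ct0 ct1 [_ _ stepE].
have : step interface 0 t = step interface 0 t.+1 by rewrite !stepE.
have := interface_step t; rewrite /step !iter_interface lexx !sub0r add0r.
rewrite (_ : (1 <= 0 :> int) = false)//.
have zeroE u : c u = 0%N -> interface (- u%:Z) = ord0.
  by move=> cu; apply/val_inj; rewrite /= interface_neg.
rewrite !zeroE// !subr0 -!(addn1 t) -!PoszD !add1n inE => /[swap] eqI.
have := c_step (t + (e + 2)).
have := congr1 (@nat_of_ord _) eqI; rewrite addn1 !interface_pos addSn => <-.
lia.
Qed.

(** Makes room for the two consecutive zeros that [c] has at a rest. *)
Lemma card_C_pi_ge2 : (2 <= #|C_pi e r|)%N.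
Proof.
have lt1 : (e + 1 < a)%N by lia. have lt2 : (e + 2 < a)%N by lia.
apply: (@leq_trans #|[set Ordinal lt1; Ordinal lt2]%SET|).
  by rewrite cards2 -val_eqE /= eqn_add2l.
apply/subset_leq_card/fintype.subsetP => i; rewrite !inE => /orP[]/eqP -> /=; lia.
Qed.

Lemma interface_Omega_var n t : (0 < n)%N -> (forall i, c (i + n) = c i) ->
  c t = 0%N -> c t.+1 = 0%N -> Omega_var interface.
Proof.
move=> n0 cn ct0 ct1; exists 0 => //; split.
- have perT : iter n gh interface = interface.
    apply/funext => q; apply/val_inj; rewrite /= iter_interface.
    case: ifP => q0.
      have -> : q = - (absz q)%:Z by lia.
      by rewrite -opprD -PoszD !interface_neg cn.
    have -> : q = (absz q).-1.+1%:Z by lia.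
    by rewrite -PoszD addSn !interface_pos addnAC cn.
  move=> U /nbhs_singleton Ux; exists n => //; exists interface; split=> //.
  by exists interface.
- exact: interface_not_const ct0 ct1.
- exact: interface_step.
- split; first exact: interface_S_Rm.
  move: #|C_pi e r| card_C_pi_ge2 => K K2 q qK zero.
  pose i := absz (q + 2)%R.
  have zi j : (j <= 2)%N -> c (j + i) = 0%N.
    by move=> j2; rewrite -interface_neg zero// /i; lia.
  exact: c_zeros (zi 0%N isT) (zi 1%N isT) (zi 2%N isT).
- split; first exact: interface_S_Lp.
  move: #|C_pi e r| card_C_pi_ge2 => K K2 q qK zero.
  pose i := absz (q - 1)%R.
  have zi j : (j <= 2)%N -> c (j + (i + (e + 2))) = 0%N.
    by move=> j2; rewrite addnA -interface_pos zero// /i; lia.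
  exact: c_zeros (zi 0%N isT) (zi 1%N isT) (zi 2%N isT).
Qed.

End Interface.
Section BitWords.
Variables (q : nat) (q0 : (0 < q)%N) (f : {ffun 'I_q -> bool}).
Local Notation L := a.*2.+1.

(* A block of length 2 a + 1 consists of two cycles, one of which rests for an
   extra unit of time at 0; the bit tells which one. *)
Definition bit_block (b : bool) s : nat := if (s < a + b)%N then (s - b)%N else (s - a - 1)%N.

Definition bit_word t : nat :=
  bit_block (f (Ordinal (ltn_pmod (t %/ L) q0))) (t %% L).

Lemma bit_word_lt t : (bit_word t < a)%N.
Proof.
have := ltn_pmod t (ltn0Sn a.*2); rewrite /bit_word /bit_block; case: (f _) => /=; case: ifP; lia.
Qed.

Lemma bit_word_shift t j : (t %% L + j < L)%N ->
  bit_word (t + j) = bit_block (f (Ordinal (ltn_pmod (t %/ L) q0))) (t %% L + j).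
Proof.
move=> jL; have tj : (t + j = t %/ L * L + (t %% L + j))%N.
  by rewrite {1}(divn_eq t L) addnA.
rewrite /bit_word; congr (bit_block (f _) _); last by rewrite tj modnMDl modn_small.
by apply/val_inj; rewrite /= tj divnMDl// (divn_small jL) addn0.
Qed.

Lemma bit_word_at (i : 'I_q) s : (s < L)%N -> bit_word (i * L + s) = bit_block (f i) s.
Proof.
move=> sL; rewrite /bit_word; congr (bit_block (f _) _).
  by apply/val_inj; rewrite /= divnMDl// divn_small// addn0 modn_small.
by rewrite modnMDl modn_small.
Qed.

Lemma bit_word_periodic t : bit_word (t + q * L) = bit_word t.
Proof.
rewrite /bit_word addnC; congr (bit_block (f _) _); last by rewrite modnMDl.
by apply/val_inj; rewrite /= divnMDl// modnDl.
Qed.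

Lemma bit_word_next t :
  (exists b s, [/\ (s < a.*2)%N, bit_word t = bit_block b s,
       bit_word t.+1 = bit_block b s.+1 &
       (s.+1 < a.*2)%N -> bit_word t.+2 = bit_block b s.+2]) \/
  bit_word t = (e + r)%N /\ bit_word t.+1 = 0%N.
Proof.
have sL := ltn_pmod t (ltn0Sn a.*2).
have [lt|ge] := ltnP (t %% L) a.*2.
  left; exists (f (Ordinal (ltn_pmod (t %/ L) q0))), (t %% L)%N; split=> //.
  - by rewrite -[t.+1]addn1 bit_word_shift addn1.
  - by move=> lt'; rewrite -[t.+2]addn2 bit_word_shift addn2.
right; have st : (t %% L = a.*2)%N by lia.
split; first by rewrite /bit_word /bit_block st; case: (f _) => /=; case: ifP; lia.
rewrite /bit_word /bit_block modn_succ st eqxx.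
by case: (f _).
Qed.

Lemma bit_word_step t : bit_word t.+1 = (bit_word t).+1 \/
  (bit_word t = 0 /\ bit_word t.+1 = 0 \/ bit_word t = e + r /\ bit_word t.+1 = 0)%N.
Proof.
have [[b [s [sa -> -> _]]]|?] := bit_word_next t; last by right; right.
by rewrite /bit_block; case: b => /=; case: ifP; case: ifP; lia.
Qed.

Lemma bit_word_zeros t : bit_word t = 0%N -> bit_word t.+1 = 0%N -> bit_word t.+2 <> 0%N.
Proof.
have [[b [s [sa -> ->]]]|[-> _]] := bit_word_next t; last by move: r0; lia.
have [sa'|sa'] := ltnP s.+1 a.*2; [move=> /(_ isT) ->|move=> _];
  by rewrite /bit_block; case: b => /=; repeat case: ifP; lia.
Qed.

End BitWords.

Lemma htop_Omega_var_gt0 (R : realType) : (0 < htop R (@Omega_var e r))%E.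
Proof.
apply: (@lt_le_trans _ _ (ln 2%:R / (a.*2.+1)%:R)%:E).
  by rewrite lte_fin divr_gt0 ?ltr0n// ln_gt0// ltr1n.
apply: (@entropy_ge _ _ _ _ _ (2 ^ (- 0%:Z))) => //.
move=> q q0.
have -> : (2 ^ q)%N = #|{ffun 'I_q -> bool}| by rewrite card_ffun card_bool card_ord.
pose c f := bit_word q0 f.
apply: (@sep_card_ge_family _ _ _ _ _ (fun f => interface (c f))).
(* [t0] is where the first block rests: at its start if its bit is true, after one full cycle
   otherwise. *)
- move=> f; pose t0 := if f (Ordinal q0) then 0%N else a.
  have rest s : (s <= a + 1)%N -> c f s = bit_block (f (Ordinal q0)) s.
    by move=> sa; rewrite /c -(bit_word_at q0 f (Ordinal q0)); [|lia].
  apply: (@interface_Omega_var _ _ _ _ (q * a.*2.+1) t0).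
  + exact: bit_word_lt.
  + exact: bit_word_step.
  + exact: bit_word_zeros.
  + by rewrite muln_gt0 q0.
  + exact: bit_word_periodic.
  + by rewrite rest /t0 /bit_block; case: (f _) => /=; try case: ifP; lia.
  + by rewrite rest /t0 /bit_block; case: (f _) => /=; try case: ifP; lia.
- exact: exprz_gt0.
- move=> f g fg.
  have [i fgi] : exists i : 'I_q, f i != g i.
    apply/existsP; apply: contraNT fg; rewrite negb_exists => /forallP fg.
    by apply/eqP/ffunP => i; apply/eqP; rewrite -[_ == _]negbK.
  exists (i * a.*2.+1 + 1)%N.
    by apply: (@leq_trans (i.+1 * a.*2.+1)); [rewrite mulSn; lia|rewrite leq_mul2r ltn_ord orbT].
  apply: (@dist_gt _ _ _ _ _ _ 0) => //.
  move=> /(congr1 (@nat_of_ord _)).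
  (* Site 0 reads [c] directly, and at position 1 of a block the state is 0 if the first cycle rests
     and 1 otherwise. *)
  have val (h : {ffun 'I_q -> bool}) :
      iter (i * a.*2.+1 + 1) gh (interface (c h)) 0 = ~~ h i :> nat.
    rewrite (iter_interface (bit_word_lt q0 h) (bit_word_step q0 h)
      (@bit_word_zeros _ q0 h)) lexx sub0r (interface_neg (bit_word_lt q0 h)).
    rewrite /c bit_word_at; last by lia.
    by rewrite /bit_block; case: (h i) => /=; case: ifP; lia.
  by rewrite !val; move: fgi; case: (f i); case: (g i).
- by move=> x; rewrite dist_refl exprz_gt0.
Qed.

End OmegaVarLower.

Theorem theorem4p2 (R : realType) (e r : nat) (he : (0 < e)%N) (hr : (0 < r)%N) :
  exists rho : R,
    [/\ forall x : R,
          0 < x /\ root ('X^(e + r + 1) - 'X^(e + r) - 1 : {poly R}) x <->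
          x = rho,
        htop R [set: config e r] = htop R (@Z e r),
        htop R (@Z e r) = (2 * ln rho)%:E,
        htop R (@Omega_const e r) = 0%E
      & (e + 1 < r)%N ->
        (0 < htop R (@Omega_var e r) < (2 * ln rho)%:E)%E].
Proof.
have [|rho [rho1 rhoE rho_unique]] := @characteristic_root R (e + r).
  by rewrite addn_gt0 he.
have rho0 : 0 < rho by apply: lt_trans rho1.
have htopE := @htop_eq e r he hr R rho _ _ rho1 rhoE.
exists rho; split.
- move=> x; rewrite rootE !hornerE addn1; split=> [[x0 /eqP xE]|->].
    by apply: rho_unique => //; lra.
  by split=> //; rewrite rhoE; apply/eqP; ring.
- by rewrite !htopE.
- by rewrite htopE.
- apply/eqP; rewrite eq_le entropy_ge0 andbT; apply/lee_addgt0Pr => eps eps0.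
  (* Any growth rate above 1 bounds the columns; this one makes the entropy bound equal to [eps]. *)
  have : 1 < expR (eps / 2) by rewrite expR_gt1 divr_gt0.
  move=> /(htop_Omega_const_le he hr)/le_trans; apply.
  by rewrite expRK add0e lee_fin mulrC divfK.
- move=> er; rewrite htop_Omega_var_gt0//=.
  have [mu [mu1 mu_rho muP]] := growth_rate_gap #|C_pi e r| rho1 rhoE.
  apply: le_lt_trans (htop_Omega_var_le he hr erefl mu1 muP) _.
  by rewrite lte_fin ltr_pM2l// ltr_ln ?posrE// (lt_trans _ mu1).
Qed.
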